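(* Let $(X,\phi)$ be a calibrated manifold of degree $p$. Suppose $(M,\Gamma)$ is a compact $\phi$-submanifold $M\subset X$ with boundary $\Gamma=\partial M$, every connected component of which has non-empty boundary. Then for each function $f\in C^\infty(X)$ which is $\phi$-pluriharmonic mod $d$ and each point $x\in M$, one has $$\inf_\Gamma f\ \le\ f(x)\ \le\ \sup_\Gamma f .$$
   Context: A calibrated manifold $(X,\phi)$ of degree $p\ge 1$ is a smooth riemannian manifold $X$ together with a closed smooth $p$-form $\phi$ such that $\phi(\xi)\le 1$ for every unit simple tangent $p$-vector $\xi$ on $X$. $G(\phi)$ denotes the set of unit simple tangent $p$-vectors $\xi$ with $\phi(\xi)=1$ ($\phi$-planes). A $\phi$-submanifold is an oriented $p$-dimensional submanifold whose oriented unit tangent $p$-vector at each point belongs to $G(\phi)$. For $f\in C^\infty(X)$, set $d^\phi f=\nabla f\,\lrcorner\,\phi$ (interior product of the gradient with $\phi$) and $dd^\phi f=d(d^\phi f)$. The function $f$ is $\phi$-pluriharmonic mod $d$ if $$dd^\phi f=df\wedge\alpha_f+\sigma_f$$ for some smooth $(p-1)$-form $\alpha_f$ and some smooth $p$-form $\sigma_f$ on $X$ satisfying $\sigma_f(\xi)=0$ for all $\xi\in G(\phi)$. *)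

(* Defs.v *)
(* Smooth manifolds, tensors and submanifolds in coordinates.  Vectors are row
   vectors; a tensor field is the family of its local representatives, one in
   each chart of the maximal atlas, subject to the usual transformation law.
   Off the image of a chart a local representative is junk and is never
   looked at. *)
From mathcomp Require Import all_boot all_order all_algebra.
From mathcomp Require Import all_classical all_reals all_analysis.
Set Implicit Arguments.
Unset Strict Implicit.
Unset Printing Implicit Defensive.
Import Order.TTheory GRing.Theory Num.Theory.
Import numFieldNormedType.Exports.
Local Open Scope classical_set_scope.
Local Open Scope ring_scope.

(* Meaningful for U open: f is of class C^k at every point of U. *)
Fixpoint class_C (R : realType) (V W : normedModType R) (k : nat)
    (U : set V) (f : V -> W) : Prop :=
  if k is k'.+1 then
    (forall x, U x -> differentiable f x) /\
    (forall v, class_C k' U (fun x => 'D_v f x))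
  else forall x, U x -> {for x, continuous f}.

Definition smooth_on (R : realType) (V W : normedModType R)
    (U : set V) (f : V -> W) : Prop := forall k, class_C k U f.

(* A homeomorphism from the open set [cdom] onto an open subset of R^n, with
   inverse [param]; both maps are total but only constrained there. *)
Record chart (R : realType) (X : topologicalType) (n : nat) := Chart {
  cdom : set X;
  coord :> X -> 'rV[R]_n;
  param : 'rV[R]_n -> X;
  cdom_open : open cdom;
  cimg_open : open (coord @` cdom);
  coordK : forall x, cdom x -> param (coord x) = x;
  coord_continuous : forall x, cdom x -> {for x, continuous coord};
  param_continuous :
    forall y, (coord @` cdom) y -> {for y, continuous param} }.

Definition cimg (R : realType) (X : topologicalType) (n : nat)
    (c : chart R X n) : set 'rV[R]_n := c @` cdom c.

Definition overlap (R : realType) (X : topologicalType) (n : nat)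
    (c d : chart R X n) : set 'rV[R]_n := c @` (cdom c `&` cdom d).

Definition transition (R : realType) (X : topologicalType) (n : nat)
    (c d : chart R X n) : 'rV[R]_n -> 'rV[R]_n := d \o param c.

Definition compatible (R : realType) (X : topologicalType) (n : nat)
    (c d : chart R X n) : Prop :=
  smooth_on (overlap c d) (transition c d) /\
  smooth_on (overlap d c) (transition d c).

Record smooth_manifold (R : realType) (n : nat) := SmoothManifold {
  points :> topologicalType;
  atlas : set (chart R points n);
  points_hausdorff : hausdorff_space points;
  points_second_countable : @second_countable points;
  atlas_cover : forall x, exists2 c, atlas c & cdom c x;
  atlas_compatible : forall c d, atlas c -> atlas d -> compatible c d;
  atlas_maximal :
    forall c, (forall d, atlas d -> compatible c d) -> atlas c }.

Definition smooth_function (R : realType) (n : nat) (X : smooth_manifold R n)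
    (f : X -> R) : Prop :=
  forall c, atlas c -> smooth_on (cimg c) (f \o param c : 'rV[R]_n -> R).

Definition alternating_multilinear (R : realType) (n p : nat)
    (w : 'M[R]_(p, n) -> R) : Prop :=
  (forall (A B C : 'M[R]_(p, n)) (i : 'I_p) (b c : R),
     row i A = b *: row i B + c *: row i C ->
     row' i B = row' i A -> row' i C = row' i A ->
     w A = b * w B + c * w C) /\
  (forall (A : 'M[R]_(p, n)) (i j : 'I_p),
     i != j -> row i A = row j A -> w A = 0).

(* [w c y V] is the value at the point with coordinates y in the chart c of a
   (not necessarily smooth or consistent) family of p-forms, on the p vectors
   whose components in c are the rows of V. *)
Definition local_forms (R : realType) (n : nat) (X : smooth_manifold R n)
    (p : nat) : Type := chart R X n -> 'rV[R]_n -> 'M[R]_(p, n) -> R.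

Identity Coercion local_forms_fun : local_forms >-> Funclass.

Record form (R : realType) (n : nat) (X : smooth_manifold R n) (p : nat) :=
  Form {
    form_val :> local_forms X p;
    form_alt : forall c y, atlas c -> cimg c y ->
      alternating_multilinear (form_val c y);
    form_smooth : forall c V, atlas c ->
      smooth_on (cimg c) (fun y => form_val c y V : R);
    form_change : forall c d y V, atlas c -> atlas d -> overlap c d y ->
      form_val c y V =
      form_val d (transition c d y) (V *m jacobian (transition c d) y) }.

Record riemannian_metric (R : realType) (n : nat) (X : smooth_manifold R n) :=
  RiemannianMetric {
    metric_val :> chart R X n -> 'rV[R]_n -> 'M[R]_n;
    metric_sym : forall c y, atlas c -> cimg c y ->
      (metric_val c y)^T = metric_val c y;
    metric_pos : forall c y (v : 'rV[R]_n), atlas c -> cimg c y -> v != 0 ->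
      0 < (v *m metric_val c y *m v^T) 0 0;
    metric_smooth : forall c (i j : 'I_n), atlas c ->
      smooth_on (cimg c) (fun y => metric_val c y i j : R);
    metric_change : forall c d y, atlas c -> atlas d -> overlap c d y ->
      metric_val c y =
      jacobian (transition c d) y *m metric_val d (transition c d y)
        *m (jacobian (transition c d) y)^T }.

(* The rows v_1, ..., v_p of V represent the simple p-vector
   v_1 /\ ... /\ v_p, whose squared norm is the Gram determinant. *)
Definition unit_simple (R : realType) (n : nat) (X : smooth_manifold R n)
    (g : riemannian_metric X) (p : nat) (c : chart R X n) (y : 'rV[R]_n)
    (V : 'M[R]_(p, n)) : Prop := \det (V *m g c y *m V^T) = 1.

(* dw(v_0, ..., v_p) = \sum_i (-1)^i D_(v_i) (w(v_0, .., omit v_i, .., v_p))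
   for vector fields v_i with constant components. *)
Definition ext_d (R : realType) (n : nat) (X : smooth_manifold R n) (p : nat)
    (w : local_forms X p) : local_forms X p.+1 :=
  fun c y V => \sum_(i < p.+1)
    (-1) ^+ i * 'D_(row i V) (fun z => w c z (row' i V) : R) y.

(* df /\ w *)
Definition d_wedge (R : realType) (n : nat) (X : smooth_manifold R n)
    (p : nat) (f : X -> R) (w : local_forms X p) : local_forms X p.+1 :=
  fun c y V => \sum_(i < p.+1)
    (-1) ^+ i * ('D_(row i V) (f \o param c : 'rV[R]_n -> R) y
                 * w c y (row' i V)).

Definition gradient (R : realType) (n : nat) (X : smooth_manifold R n)
    (g : riemannian_metric X) (f : X -> R) (c : chart R X n) (y : 'rV[R]_n) :
    'rV[R]_n :=
  (\row_j 'D_(delta_mx 0 j) (f \o param c : 'rV[R]_n -> R) y)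
    *m invmx (g c y).

Record calibrated_manifold (R : realType) (n p : nat) := CalibratedManifold {
  carrier :> smooth_manifold R n;
  metric : riemannian_metric carrier;
  calibration : form carrier p;
  calibration_closed : forall c y V, atlas c -> cimg c y ->
    ext_d calibration c y V = 0;
  calibration_le1 : forall c y V, atlas c -> cimg c y ->
    unit_simple metric c y V -> calibration c y V <= 1 }.

(* Membership in G(phi). *)
Definition phi_plane (R : realType) (n p : nat)
    (X : calibrated_manifold R n p) (c : chart R X n) (y : 'rV[R]_n)
    (V : 'M[R]_(p, n)) : Prop :=
  unit_simple (metric X) c y V /\ calibration X c y V = 1.

(* d^phi f: the gradient is inserted in the first slot of phi. *)
Definition d_phi (R : realType) (n p : nat)
    (X : calibrated_manifold R n p.+1) (f : X -> R) : local_forms X p :=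
  fun c y W =>
    calibration X c y (col_mx (gradient (metric X) f c y) W : 'M[R]_(1 + p, n)).

Definition pluriharmonic_mod_d (R : realType) (n p : nat)
    (X : calibrated_manifold R n p.+1) (f : X -> R) : Prop :=
  exists (alpha : form X p) (sigma : form X p.+1),
    (forall c y V, atlas c -> cimg c y -> phi_plane c y V ->
       sigma c y V = 0) /\
    (forall c y V, atlas c -> cimg c y ->
       ext_d (d_phi f) c y V = d_wedge f alpha c y V + sigma c y V).

(* R^p as a subspace of R^n, for p <= n. *)
Definition coord_plane (R : realType) (n p : nat) : set 'rV[R]_n :=
  [set y | forall i : 'I_n, (p <= i)%N -> y 0 i = 0].

(* The half-space of vectors of R^p whose first coordinate is >= 0 (s = false)
   or <= 0 (s = true).  Both signs are needed to orient arcs (p = 1). *)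
Definition half_plane (R : realType) (n p : nat) (s : bool) :
    set 'rV[R]_n :=
  coord_plane p `&`
  [set y | forall i : 'I_n, i = 0%N :> nat -> 0 <= (-1) ^+ s * y 0 i].

Definition cuts_out (R : realType) (X : topologicalType) (n : nat)
    (c : chart R X n) (M : set X) (H : set 'rV[R]_n) : Prop :=
  forall x, cdom c x -> (M x <-> H (c x)).

(* Charts exhibiting M as an embedded p-dimensional submanifold with boundary
   (p > 0). *)
Definition adapted_chart (R : realType) (n : nat) (X : smooth_manifold R n)
    (p : nat) (M : set X) (c : chart R X n) : Prop :=
  [/\ (p <= n)%N, atlas c &
      cuts_out c M (coord_plane p) \/ exists s, cuts_out c M (half_plane p s)].

Definition submanifold (R : realType) (n : nat) (X : smooth_manifold R n)
    (p : nat) (M : set X) : Prop :=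
  forall x, M x -> exists2 c, adapted_chart p M c & cdom c x.

Definition manifold_boundary (R : realType) (n : nat)
    (X : smooth_manifold R n) (p : nat) (M : set X) : set X :=
  [set x | M x /\ exists (c : chart R X n) (s : bool),
     [/\ (p <= n)%N, atlas c, cdom c x, cuts_out c M (half_plane p s) &
         forall i : 'I_n, i = 0%N :> nat -> c x 0 i = 0]].

(* [pid_mx p] has rows e_1, ..., e_p, which span the tangent space of M in an
   adapted chart. *)
Definition tangent_jacobian (R : realType) (n p : nat) (J : 'M[R]_n) :
    'M[R]_p :=
  (pid_mx p : 'M[R]_(p, n)) *m J *m (pid_mx p : 'M[R]_(n, p)).

(* An orientation of M, as a set of adapted charts which covers M and whose
   changes of coordinates, restricted to M, have positive determinant. *)
Definition orientation (R : realType) (n : nat) (X : smooth_manifold R n)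
    (p : nat) (M : set X) (O : set (chart R X n)) : Prop :=
  [/\ O `<=` adapted_chart p M,
      forall x, M x -> exists2 c, O c & cdom c x &
      forall c d x, O c -> O d -> M x -> cdom c x -> cdom d x ->
        0 < \det (tangent_jacobian p (jacobian (transition c d) (c x)))].

(* For c in the orientation: V represents the oriented unit tangent p-vector
   of M at the point x. *)
Definition oriented_unit_tangent (R : realType) (n : nat)
    (X : smooth_manifold R n) (g : riemannian_metric X) (p : nat)
    (c : chart R X n) (x : X) (V : 'M[R]_(p, n)) : Prop :=
  unit_simple g c (c x) V /\
  exists2 A : 'M[R]_p, 0 < \det A & V = A *m pid_mx p.

Definition phi_submanifold (R : realType) (n p : nat)
    (X : calibrated_manifold R n p) (M : set X) (O : set (chart R X n)) :
    Prop :=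
  [/\ submanifold p M, orientation p M O &
      forall c x V, O c -> M x -> cdom c x ->
        oriented_unit_tangent (metric X) c x V -> phi_plane c (c x) V].

(* Main.v *)
Require Import Defs.
From mathcomp Require Import all_boot all_order all_algebra.
From mathcomp Require Import all_classical all_reals all_analysis.
From mathcomp Require Import ring lra zify.
Set Implicit Arguments.
Unset Strict Implicit.
Unset Printing Implicit Defensive.
Import Order.TTheory GRing.Theory Num.Theory.
Import numFieldNormedType.Exports.
Local Open Scope classical_set_scope.
Local Open Scope ring_scope.

(** Let [phi] be the calibration.  The idea is that the restriction of [f] to [M]
    satisfies a linear second order elliptic equation without zero order term,
    so that the strong maximum principle applies to it.

    At a point of [M] the calibration attains its maximum on the tangent plane.
    Tilting this plane towards a normal vector can therefore not increase [phi]
    to first order, which means that [phi] vanishes when one tangent vector is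
    replaced by a normal one ([first_cousin]).  Hence only the tangential part of
    the gradient of [f] contributes to the restriction of [d^phi f], and as [phi]
    restricts to the volume form of [M], this restriction is the Hodge star of
    [df] on [M] ([d_phi_tangent]).  The form [sigma] vanishes on the tangent
    planes of [M], so restricting the hypothesis on [f] to [M] gives
    [d * df = df /\ alpha]: in the coordinates of an adapted chart, an equation
    [sum a_ij d_i d_j u + sum b_j d_j u = 0] with [a] positive definite
    ([local_laplace_equation]).

    The strong maximum principle for such an equation is Hopf's: a solution that
    reaches its maximum [m] without being constant nearby has a contact point on
    the boundary of a ball where it is less than [m], and adding to it a small
    multiple of a barrier at that point produces an interior maximum where the
    operator is positive, which the second derivative test forbids
    ([no_touching_ball], [strong_maximum_principle]).

    Finally, if the maximum of [f] on the compact set [M] were not attained on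
    the boundary, the set where it is attained would be open and closed in [M],
    hence contain a connected component, which meets the boundary
    ([maximum_principle]).  The lower bound is the upper bound for [- f]. *)

(** * Positive definite matrices *)

Definition positive_definite (R : realType) (n : nat) (S : 'M[R]_n) : Prop :=
  S^T = S /\ forall v : 'rV[R]_n, v != 0 -> 0 < (v *m S *m v^T) 0 0.

(** The induction splits off the first coordinate; the Schur complement that
    remains is positive definite because it is the given form restricted to the
    orthogonal, for that form, of the first basis vector. *)
Lemma cholesky (R : realType) (n : nat) (S : 'M[R]_n) :
  positive_definite S -> exists L : 'M[R]_n, S = L *m L^T.
Proof.
elim: n S => [|n IH]; first by move=> S _; exists 0; apply/matrixP => -[].
rewrite -[n.+1]add1n => S [Ssym Spos].
pose a := S 0 0.
pose b : 'rV[R]_n := ursubmx S.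
pose D : 'M[R]_n := drsubmx S.
have SE : S = block_mx a%:M b b^T D .
  rewrite -[LHS](submxK S) /b /D.
  have -> : dlsubmx S = (ursubmx S)^T.
    by rewrite trmx_ursub Ssym.
  by congr block_mx; apply/matrixP => i j; rewrite !ord1 !mxE /a;
     congr (S _ _); apply: val_inj.
have DT : D^T = D.
  by rewrite /D trmx_drsub Ssym.
have a0 : 0 < a.
  have e0 : (row_mx 1%:M 0 : 'rV[R]_(1 + n)) != 0.
    apply/eqP => /(congr1 (@lsubmx _ 1 1 n)).
    rewrite row_mxKl => /matrixP/(_ 0 0); rewrite !mxE => /eqP.
    by rewrite oner_eq0.
  have := Spos _ e0.
  rewrite {1}SE (mul_row_block 1%:M 0) tr_row_mx mul_row_col.
  by rewrite !mul0mx !trmx0 !mulmx0 !addr0 trmx1 mulmx1 mul1mx mxE.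
have Dsym : (D - a^-1 *: (b^T *m b))^T = D - a^-1 *: (b^T *m b).
  by rewrite linearB /= linearZ /= trmx_mul trmxK DT.
have [|L' DL] := IH (D - a^-1 *: (b^T *m b)).
  split=> // w w0.
  have v0 : (row_mx (- (a^-1 *: (w *m b^T))) w : 'rV[R]_(1 + n)) != 0.
    apply: contra w0 => /eqP/(congr1 (@rsubmx _ 1 1 n)).
    by rewrite row_mxKr => ->; rewrite linear0.
  have := Spos _ v0; congr (0 < _).
  rewrite {1}SE (mul_row_block _ w) tr_row_mx mul_row_col.
  congr (fun_of_matrix _ 0 0).
  rewrite mulmxDl [in RHS]mulmxBr [in RHS]mulmxBl.
  rewrite -[X in X + _ = _]mulmxDl.
  have -> : - (a^-1 *: (w *m b^T)) *m a%:M + w *m b^T = 0.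
    rewrite mul_mx_scalar scalerN scalerA mulfV ?gt_eqF// scale1r.
    by rewrite addNr.
  rewrite mul0mx add0r mulmxDl addrC mulNmx mulNmx; congr (_ - _).
  by rewrite -!scalemxAl -scalemxAr -scalemxAl !mulmxA.
exists (block_mx (Num.sqrt a)%:M 0 ((Num.sqrt a)^-1 *: b^T) L' : 'M[R]_(1 + n)).
rewrite [LHS]SE (tr_block_mx (Num.sqrt a)%:M) mulmx_block.
have s0 : Num.sqrt a != 0 by rewrite gt_eqF// sqrtr_gt0.
rewrite !trmx0 !mulmx0 !mul0mx !addr0 linearZ /= trmxK tr_scalar_mx.
rewrite -scalar_mxM -expr2 sqr_sqrtr ?ltW// mul_scalar_mx scalerA mulfV//.
rewrite scale1r mul_mx_scalar scalerA mulfV// scale1r -DL.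
rewrite -scalemxAl -scalemxAr scalerA -invfM -expr2 sqr_sqrtr ?ltW//.
by rewrite addrC subrK.
Qed.

Lemma positive_definite_unit (R : realType) (n : nat) (S : 'M[R]_n) :
  positive_definite S -> S \in unitmx.
Proof.
move=> [Ssym Spos]; rewrite -row_free_unit -kermx_eq0.
apply/eqP/row_matrixP => i; rewrite row0; apply/eqP/negPn/negP => /Spos.
by rewrite -row_mul mulmx_ker row0 mul0mx mxE ltxx.
Qed.

Lemma positive_definite_det_gt0 (R : realType) (n : nat) (S : 'M[R]_n) :
  positive_definite S -> 0 < \det S.
Proof.
move=> pS; have := positive_definite_unit pS; rewrite unitmxE unitfE => d0.
have [L SL] := cholesky pS.
rewrite lt_neqAle eq_sym d0 SL det_mulmx det_tr -expr2; exact: sqr_ge0.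
Qed.

Lemma positive_definiteZ (R : realType) (n : nat) (k : R) (S : 'M[R]_n) :
  0 < k -> positive_definite S -> positive_definite (k *: S).
Proof.
move=> k0 [Ssym Spos]; split; first by rewrite linearZ /= Ssym.
by move=> v v0; rewrite -scalemxAr -scalemxAl mxE mulr_gt0// Spos.
Qed.

Lemma positive_definiteV (R : realType) (n : nat) (S : 'M[R]_n) :
  positive_definite S -> positive_definite (invmx S).
Proof.
move=> pS; have uS := positive_definite_unit pS; have [Ssym Spos] := pS.
split=> [|v v0]; first by rewrite trmx_inv Ssym.
have : v *m invmx S != 0.
  by apply: contra v0 => /eqP h; rewrite -(mulmxKV uS v) h mul0mx.
move=> /Spos; rewrite mulmxKV// trmx_mul trmx_inv Ssym mulmxA; exact.
Qed.

(** The right inverse [F] witnesses that the rows of [E] are independent. *)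
Lemma positive_definite_gram (R : realType) (m n : nat) (S : 'M[R]_n)
    (E : 'M[R]_(m, n)) (F : 'M[R]_(n, m)) :
  E *m F = 1%:M -> positive_definite S -> positive_definite (E *m S *m E^T).
Proof.
move=> EF [Ssym Spos]; split=> [|v v0].
  by rewrite !trmx_mul trmxK Ssym mulmxA.
have : v *m E != 0.
  by apply: contra v0 => /eqP h; rewrite -(mulmx1 v) -EF mulmxA h mul0mx.
by move=> /Spos; rewrite trmx_mul !mulmxA.
Qed.

(** With [S = L L^T] the sum is the sum of the values of the quadratic form
    [H] on the columns of [L]. *)
Lemma trace_positive_le0 (R : realType) (n : nat) (S : 'M[R]_n)
    (H : 'I_n -> 'I_n -> R) :
  positive_definite S ->
  (forall v : 'rV[R]_n, \sum_i \sum_j v 0 i * v 0 j * H i j <= 0) ->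
  \sum_i \sum_j S i j * H i j <= 0.
Proof.
move=> /cholesky[L ->] Hle.
suff -> : \sum_i \sum_j (L *m L^T) i j * H i j =
    \sum_k \sum_i \sum_j (row k L^T) 0 i * (row k L^T) 0 j * H i j.
  by apply: sumr_le0 => k _; exact: Hle.
rewrite [RHS]exchange_big; apply: eq_bigr => i _.
rewrite [RHS]exchange_big; apply: eq_bigr => j _.
rewrite mxE mulr_suml; apply: eq_bigr => k _.
by rewrite !mxE.
Qed.

(** * Alternating forms on the rows of a matrix *)

Definition set_row (R : realType) (m n : nat) (i : 'I_m) (v : 'rV[R]_n)
    (A : 'M[R]_(m, n)) : 'M[R]_(m, n) :=
  \matrix_(k < m) (if k == i then v else row k A).

Lemma row_set_row (R : realType) m n (i k : 'I_m) (v : 'rV[R]_n)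
    (A : 'M[R]_(m, n)) :
  row k (set_row i v A) = if k == i then v else row k A.
Proof. exact: rowK. Qed.

Lemma row'_set_row (R : realType) m n (i : 'I_m) (v : 'rV[R]_n)
    (A : 'M[R]_(m, n)) : row' i (set_row i v A) = row' i A.
Proof.
by apply/matrixP => k j; rewrite !mxE eq_sym (negbTE (neq_lift _ _)) mxE.
Qed.

Lemma set_row_id (R : realType) m n (i : 'I_m) (A : 'M[R]_(m, n)) :
  set_row i (row i A) A = A.
Proof.
by apply/row_matrixP => k; rewrite row_set_row; case: eqP => [->|].
Qed.

Lemma set_rowC (R : realType) m n (i j : 'I_m) (v w : 'rV[R]_n)
    (A : 'M[R]_(m, n)) :
  i != j -> set_row i v (set_row j w A) = set_row j w (set_row i v A).
Proof.
move=> ij; apply/row_matrixP => k; rewrite !row_set_row.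
by case: (eqVneq k i) => // ->; rewrite (negbTE ij).
Qed.

Lemma set_row_mul (R : realType) m n q (i : 'I_m) (v : 'rV[R]_n)
    (A : 'M[R]_(m, n)) (B : 'M[R]_(n, q)) :
  set_row i (v *m B) (A *m B) = set_row i v A *m B.
Proof.
apply/row_matrixP => k; rewrite row_mul !row_set_row row_mul.
by case: ifP.
Qed.

Section Alternating.
Context (R : realType) (m n : nat).
Variable w : 'M[R]_(m, n) -> R.
Hypothesis altw : alternating_multilinear w.

Lemma alt_set_row_linear (i : 'I_m) (b c : R) (u v : 'rV[R]_n)
    (A : 'M[R]_(m, n)) :
  w (set_row i (b *: u + c *: v) A)
  = b * w (set_row i u A) + c * w (set_row i v A).
Proof.
apply: (altw.1 _ _ _ i); rewrite ?row'_set_row//.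
by rewrite !row_set_row eqxx.
Qed.

Lemma alt_set_rowD (i : 'I_m) (u v : 'rV[R]_n) (A : 'M[R]_(m, n)) :
  w (set_row i (u + v) A) = w (set_row i u A) + w (set_row i v A).
Proof.
by have := alt_set_row_linear i 1 1 u v A; rewrite !scale1r !mul1r.
Qed.

Lemma alt_set_rowZ (i : 'I_m) (c : R) (v : 'rV[R]_n) (A : 'M[R]_(m, n)) :
  w (set_row i (c *: v) A) = c * w (set_row i v A).
Proof.
by have := alt_set_row_linear i c 0 v 0 A; rewrite scale0r addr0 mul0r addr0.
Qed.

Lemma alt_set_row_sum (i : 'I_m) k (c : 'I_k -> R) (v : 'I_k -> 'rV[R]_n)
    (A : 'M[R]_(m, n)) :
  w (set_row i (\sum_j c j *: v j) A) = \sum_j c j * w (set_row i (v j) A).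
Proof.
apply: (big_ind2 (fun u x => w (set_row i u A) = x)) => [|u x v' y <- <-|j _].
- by rewrite -(scale0r 0) alt_set_rowZ mul0r.
- exact: alt_set_rowD.
- exact: alt_set_rowZ.
Qed.

Lemma alt_set_row_other (i k : 'I_m) (A : 'M[R]_(m, n)) :
  k != i -> w (set_row i (row k A) A) = 0.
Proof.
move=> ki; apply: (altw.2 _ i k); first by rewrite eq_sym.
by rewrite !row_set_row eqxx (negbTE ki).
Qed.

Lemma alt_swap (i j : 'I_m) (u v : 'rV[R]_n) (A : 'M[R]_(m, n)) :
  i != j -> w (set_row i u (set_row j v A)) = - w (set_row i v (set_row j u A)).
Proof.
move=> ij; pose W x y := w (set_row i x (set_row j y A)).
have W0 x : W x x = 0.
  by apply: (altw.2 _ i j ij); rewrite !row_set_row eqxx eq_sym (negbTE ij) eqxx.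
have Wl x y z : W (x + y) z = W x z + W y z by exact: alt_set_rowD.
have Wr x y z : W x (y + z) = W x y + W x z.
  by rewrite /W !(set_rowC _ _ _ ij); exact: alt_set_rowD.
apply/eqP; rewrite -addr_eq0; apply/eqP.
by have := W0 (u + v); rewrite Wl !Wr !W0 add0r addr0.
Qed.

End Alternating.

Lemma det_alternating (R : realType) (m : nat) :
  alternating_multilinear (fun A : 'M[R]_m => \det A).
Proof.
split=> [A B C i b c h1 h2 h3|A i j ij h].
  exact: determinant_multilinear h1 h2 h3.
apply: (determinant_alternate ij) => k.
by move/rowP: h => /(_ k); rewrite !mxE.
Qed.

(** Intermediate between [col_mx v T] and [set_row k v A] with [T = row' k A]:
    moving the slot [k] one step at a time keeps track of the sign. *)
Definition insert_row (R : realType) (m n : nat) (k : 'I_m.+1) (v : 'rV[R]_n)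
    (T : 'M[R]_(m, n)) : 'M[R]_(m.+1, n) :=
  \matrix_(i < m.+1) (if unlift k i is Some j then row j T else v).

Lemma insert_row0 (R : realType) m n (v : 'rV[R]_n) (T : 'M[R]_(m, n)) :
  insert_row 0 v T = col_mx v T.
Proof.
apply/row_matrixP => i; rewrite rowK.
case: unliftP => [j ->|->].
  by rewrite -[LHS](rowKd j v T); congr row; exact: val_inj.
rewrite -[LHS](row_id 0) -[LHS](rowKu 0 v T); congr row; exact: val_inj.
Qed.

Lemma insert_row_row' (R : realType) m n (i : 'I_m.+1) (v : 'rV[R]_n)
    (A : 'M[R]_(m.+1, n)) : insert_row i v (row' i A) = set_row i v A.
Proof.
apply/row_matrixP => k; rewrite rowK row_set_row.
case: unliftP => [j ->|->]; last by rewrite eqxx.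
rewrite eq_sym (negbTE (neq_lift _ _)).
by apply/rowP => l; rewrite !mxE.
Qed.

(** Adjacent slots differ by one transposition. *)
Lemma alt_insert_rowS (R : realType) m n (w : 'M[R]_(m.+1, n) -> R)
    (k k' : 'I_m.+1) (v : 'rV[R]_n) (T : 'M[R]_(m, n)) :
  alternating_multilinear w -> k' = k.+1 :> nat ->
  w (insert_row k' v T) = - w (insert_row k v T).
Proof.
move=> altw kk'; have kNk' : k != k'.
  by rewrite -val_eqE /= kk' neq_ltn ltnSn.
set A := insert_row k v T.
have -> : insert_row k' v T = set_row k (row k' A) (set_row k' v A).
  have km : (k < m)%N by rewrite -ltnS -kk'.
  pose j0 := Ordinal km.
  have kl : k = lift k' j0.
    by apply: val_inj; rewrite /= /bump kk' ltnn.
  have kl' : k' = lift k j0.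
    by apply: val_inj; rewrite /= /bump leqnn kk'.
  apply/row_matrixP => i; rewrite rowK !row_set_row.
  case: (eqVneq i k) => [->|ik].
    by rewrite [in LHS]kl liftK /A rowK [in RHS]kl' liftK.
  case: (eqVneq i k') => [->|ik']; first by rewrite unlift_none.
  rewrite /A rowK.
  case: unliftP => [j ij|ij]; last by rewrite ij eqxx in ik'.
  case: unliftP => [j' ij'|ij']; last by rewrite ij' eqxx in ik.
  congr row; apply: val_inj.
  move: ik ik'; rewrite -!val_eqE /= => ik ik'.
  have := congr1 val ij; have := congr1 val ij'; rewrite /= /bump.
  move: ik ik'; rewrite kk'; lia.
rewrite (alt_swap altw _ _ _ kNk'); congr (- w _).
apply/row_matrixP => i; rewrite !row_set_row.
case: (eqVneq i k) => [->|ik]; first by rewrite /A rowK unlift_none.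
by case: (eqVneq i k') => [->|].
Qed.

Lemma alt_col_mx_row' (R : realType) m n (w : 'M[R]_(m.+1, n) -> R)
    (i : 'I_m.+1) (v : 'rV[R]_n) (A : 'M[R]_(m.+1, n)) :
  alternating_multilinear w ->
  w (col_mx v (row' i A) : 'M[R]_(1 + m, n)) = (-1) ^+ i * w (set_row i v A).
Proof.
move=> altw; rewrite -insert_row_row' -insert_row0.
move: (row' i A) => T.
suff H k (km : (k < m.+1)%N) :
    w (insert_row (Ordinal km) v T) = (-1) ^+ k * w (insert_row 0 v T).
  case: i => i im; rewrite H /= mulrA -exprD addnn -mul2n exprM sqrrN !expr1n.
  by rewrite mul1r.
elim: k km => [|k IH] km.
  by rewrite expr0 mul1r; congr (w (insert_row _ _ _)); apply: val_inj.
have km' : (k < m.+1)%N by exact: ltnW.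
rewrite (@alt_insert_rowS _ _ _ _ (Ordinal km'))// IH exprS.
by rewrite mulN1r mulNr.
Qed.

(** * The first cousin principle *)

Lemma det_gram_set_rowZ (R : realType) m n (i : 'I_m) (c : R)
    (A : 'M[R]_(m, n)) (G : 'M[R]_n) :
  \det (set_row i (c *: row i A) A *m G *m (set_row i (c *: row i A) A)^T)
  = c ^+ 2 * \det (A *m G *m A^T).
Proof.
have -> : set_row i (c *: row i A) A = set_row i (c *: row i 1%:M) 1%:M *m A.
  by rewrite -set_row_mul -scalemxAl -row_mul mul1mx.
set D := set_row _ _ _.
have -> : D *m A *m G *m (D *m A)^T = D *m (A *m G *m A^T) *m D^T.
  by rewrite trmx_mul !mulmxA.
rewrite !det_mulmx det_tr.
have -> : \det D = c.
  rewrite /D (alt_set_rowZ (@det_alternating R m)) set_row_id det1 mulr1//.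
by rewrite mulrAC -expr2.
Qed.

(** The bound on unit simple vectors extends by homogeneity, rescaling one row. *)
Lemma comass_le_sqrt_gram (R : realType) m n (w : 'M[R]_(m.+1, n) -> R)
    (G : 'M[R]_n) (V : 'M[R]_(m.+1, n)) :
  alternating_multilinear w ->
  (forall V, \det (V *m G *m V^T) = 1 -> w V <= 1) ->
  0 < \det (V *m G *m V^T) -> w V <= Num.sqrt (\det (V *m G *m V^T)).
Proof.
move=> altw w1 d0; set d := \det _ in d0 *.
have s0 : 0 < Num.sqrt d by rewrite sqrtr_gt0.
have := w1 (set_row 0 ((Num.sqrt d)^-1 *: row 0 V) V).
rewrite det_gram_set_rowZ -/d exprVn (sqr_sqrtr (ltW d0)) mulVf ?gt_eqF//.
move=> /(_ erefl).
by rewrite alt_set_rowZ// set_row_id mulrC ler_pdivrMr// mul1r.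
Qed.

(** Both sides agree at [t = 0], where the right hand side has derivative
    zero. *)
Lemma touching_sqrt_slope0 (R : realType) (s a C : R) :
  0 < s ->
  (forall t, 0 < s ^+ 2 + t ^+ 2 * C ->
     s + t * a <= Num.sqrt (s ^+ 2 + t ^+ 2 * C)) ->
  a = 0.
Proof.
move=> s0 H; apply/eqP/negPn/negP => a0.
(* at [t = s e] the slope contributes [2 a e] to the square of the left hand
   side, the curvature at most [e^2 b <= a e] to that of the right hand side *)
pose b := `|C| + 1; pose d := 1 + `|a|.
have b0 : 0 < b by rewrite ltr_wpDl.
have d0 : 0 < d by rewrite ltr_pwDl.
have [Cb1 Cb2] : - b <= C /\ C <= b.
  by have := ler_norm C; have := ler_norm (- C); rewrite normrN /b; split; lra.
pose e := a / (b * d).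
have ae : 0 < a * e.
  rewrite /e mulrA -expr2; apply: divr_gt0; last exact: mulr_gt0.
  by rewrite exprn_even_gt0.
have eb : e ^+ 2 * b * d = a * e.
  by rewrite /e; field; rewrite !gt_eqF.
have e2b : e ^+ 2 * b <= a * e.
  by rewrite -eb ler_peMr ?(mulr_ge0 _ (ltW b0)) ?sqr_ge0// /d lerDl.
have e2b1 : e ^+ 2 * b < 1.
  have -> : e ^+ 2 * b = (a / d) ^+ 2 / b by rewrite /e; field; rewrite !gt_eqF.
  rewrite ltr_pdivrMr// mul1r.
  have : (a / d) ^+ 2 < 1.
    rewrite -[ltRHS](expr1n _ 2) -[ltLHS]real_normK ?num_real// ltr_pXn2r ?nnegrE//.
    rewrite normrM normfV (gtr0_norm d0) ltr_pdivrMr// mul1r /d.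
    by rewrite ltrDr.
  by move/lt_le_trans; apply; rewrite /b lerDr.
have e20 : 0 <= e ^+ 2 by exact: sqr_ge0.
have eC1 : - (e ^+ 2 * b) <= e ^+ 2 * C by rewrite -mulrN ler_wpM2l.
have eC2 : e ^+ 2 * C <= e ^+ 2 * b by rewrite ler_wpM2l.
have rhs : s ^+ 2 + (s * e) ^+ 2 * C = s ^+ 2 * (1 + e ^+ 2 * C) by ring.
have s20 : 0 < s ^+ 2 by rewrite exprn_gt0.
have r0 : 0 < s ^+ 2 * (1 + e ^+ 2 * C) by apply: mulr_gt0 => //; lra.
have := H (s * e); rewrite rhs => /(_ r0).
have -> : s + s * e * a = s * (1 + a * e) by ring.
have l0 : 0 <= s * (1 + a * e) by apply: mulr_ge0; lra.
rewrite -ler_sqr ?nnegrE ?sqrtr_ge0// (sqr_sqrtr (ltW r0)) exprMn ler_pM2l//.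
have := sqr_ge0 (a * e); nra.
Qed.

(** A form of comass at most one that attains its comass on the plane of the
    rows of [E] vanishes as soon as one of these rows is replaced by a vector
    normal to the plane: otherwise tilting the plane towards that vector would
    raise its value to first order, whereas the volume only grows to second
    order.  Hence only the tangential component of the new vector counts. *)
Lemma first_cousin (R : realType) m n (w : 'M[R]_(m.+1, n) -> R)
    (G : 'M[R]_n) (E : 'M[R]_(m.+1, n)) (i : 'I_m.+1) (v : 'rV[R]_n) :
  alternating_multilinear w ->
  (forall V, \det (V *m G *m V^T) = 1 -> w V <= 1) ->
  G^T = G -> positive_definite (E *m G *m E^T) ->
  w E = Num.sqrt (\det (E *m G *m E^T)) ->
  w (set_row i v E) = w E * (v *m G *m E^T *m invmx (E *m G *m E^T)) 0 i.
Proof.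
move=> altw w1 Gsym pS wE; set S := E *m G *m E^T in pS wE *.
have uS := positive_definite_unit pS.
have d0 := positive_definite_det_gt0 pS.
have normal u : u *m G *m E^T = 0 -> w (set_row i u E) = 0.
  move=> uE; have Eu : E *m G *m u^T = 0.
    by apply: trmx_inj; rewrite !trmx_mul trmxK Gsym mulmxA uE trmx0.
  set c := (u *m G *m u^T) 0 0.
  pose K := \det (set_row i (delta_mx 0 i) S).
  apply: (@touching_sqrt_slope0 _ (w E) _ (c * K)) => [|t].
    by rewrite wE sqrtr_gt0.
  have -> : w E + t * w (set_row i u E) = w (set_row i (row i E + t *: u) E).
    by rewrite alt_set_rowD// alt_set_rowZ// set_row_id.
  have -> : w E ^+ 2 + t ^+ 2 * (c * K) =
      \det (set_row i (row i E + t *: u) E *m G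
              *m (set_row i (row i E + t *: u) E)^T).
    have -> : set_row i (row i E + t *: u) E
        = E + t *: ((delta_mx i 0 : 'cV_m.+1) *m u).
      apply/row_matrixP => k; rewrite row_set_row [RHS]linearD linearZ /=.
      rewrite row_mul.
      have -> : row k (delta_mx i 0 : 'cV[R]_m.+1) = (k == i)%:R%:M.
        by apply/rowP => l; rewrite !mxE !ord1 !eqxx andbT.
      rewrite mul_scalar_mx; case: eqP => [->|_]; first by rewrite scale1r.
      by rewrite scale0r scaler0 addr0.
    set X := _ *m u.
    have XE : X *m G *m E^T = 0 by rewrite /X -!mulmxA [u *m _]mulmxA uE mulmx0.
    have EX : E *m G *m X^T = 0 by rewrite /X trmx_mul mulmxA Eu mul0mx.
    have -> : (E + t *: X) *m G *m (E + t *: X)^T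
        = set_row i (row i S + (t ^+ 2 * c) *: delta_mx 0 i) S.
      rewrite linearD linearZ /= !mulmxDl !mulmxDr -!scalemxAl -!scalemxAr.
      rewrite XE EX !scaler0 addr0 add0r scalerA -expr2 -/S.
      have -> : X *m G *m X^T = c *: delta_mx i i.
        rewrite /X trmx_mul -!mulmxA [u *m (G *m _)]mulmxA [u *m G *m _]mulmxA.
        rewrite [u *m G *m u^T]mx11_scalar -/c mul_scalar_mx -scalemxAr.
        by rewrite trmx_delta mul_delta_mx.
      rewrite scalerA; apply/row_matrixP => k.
      rewrite row_set_row linearD linearZ /=; case: eqP => [->|/eqP ki].
        by rewrite [row _ (delta_mx _ _)]rowE mul_delta_mx.
      by rewrite [row _ (delta_mx _ _)]rowE mul_delta_mx_0// scaler0 addr0.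
    have da := @det_alternating R m.+1.
    rewrite (alt_set_rowD da) (alt_set_rowZ da) set_row_id.
    by rewrite wE (sqr_sqrtr (ltW d0)) mulrA.
  exact: comass_le_sqrt_gram.
set T := v *m G *m E^T *m invmx S.
have -> : v = \sum_j T 0 j *: row j E + (v - T *m E).
  by rewrite -mulmx_sum_row addrC subrK.
rewrite alt_set_rowD// (normal (v - _)) ?addr0; last first.
  rewrite !mulmxBl -[T *m E *m G]mulmxA -[T *m _ *m E^T]mulmxA -/S.
  by rewrite /T mulmxKV// subrr.
rewrite alt_set_row_sum// (bigD1 i)//= set_row_id big1 => [|j ji].
  by rewrite addr0 mulrC.
by rewrite alt_set_row_other// mulr0.
Qed.

(** * Derivatives at a maximum *)

Section SecondDerivative.
Context (R : realType) (V : normedModType R).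
Variables (w : V -> R) (z v : V).

Let line (t : R) : V := t *: v + z.

Let derive_line (k : V -> R) (t : R) :
  derivable k (line t) v ->
  is_derive t 1 (k \o line) ('D_v k (line t)).
Proof.
have e : (fun h : R => h^-1 *: (((k \o line) \o shift t) (h *: 1) - (k \o line) t))
    = (fun h => h^-1 *: ((k \o shift (line t)) (h *: v) - k (line t))).
  apply/funext => h /=; congr (_ *: (k _ - _)).
  by rewrite /line /= [h *: 1]mulr1 scalerDl addrA.
by move=> dk; split; rewrite /derivable /derive e.
Qed.

Let near_line (P : V -> Prop) : (\forall y \near z, P y) ->
  \forall t \near (0 : R), P (line t).
Proof.
have lineC : {for 0, continuous line}.
  apply: cvgD; last exact: cvg_cst.
  by apply: cvgZ; [exact: cvg_id | exact: cvg_cst].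
by have : line 0 = z by [rewrite /line scale0r add0r]; move=> <-; exact: lineC.
Qed.

(** If the second derivative were positive, the first one would be positive just
    after [z] along the line directed by [v], and [w] would increase there. *)
Lemma derive_max :
  (\forall y \near z, differentiable w y) ->
  (\forall y \near z, w y <= w z) ->
  derivable ('D_v w) z v ->
  'D_v w z = 0 /\ 'D_v ('D_v w) z <= 0.
Proof.
move=> dw wle ddw.
have line0 : line 0 = z by rewrite /line scale0r add0r.
have [e /= e0 He] : exists2 e : R, 0 < e & forall t, `|t| < e ->
    differentiable w (line t) /\ w (line t) <= w z.
  have : \forall t \near (0 : R), differentiable w (line t) /\ w (line t) <= w z.
    apply: (near_line (P := fun y => differentiable w y /\ w y <= w z)).
    by near do split.
  move=> /nbhs_ballP[e e0 He]; exists e => // t te.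
  by apply: He; rewrite /ball /= sub0r normrN.
have dg (t : R) : `|t| < e -> is_derive t 1 (w \o line) ('D_v w (line t)).
  by move=> /He[d _]; apply/derive_line/diff_derivable.
have Dw0 : 'D_v w z = 0.
  have e1 t : t \in `]-e, e[ -> `|t| < e by rewrite in_itv /= ltr_norml.
  have [] : is_derive (0 : R) 1 (w \o line) 0.
    apply: (@derive1_at_max R (w \o line) (- e) e 0).
    - by rewrite (le_trans (y := 0)) ?oppr_le0 ?(ltW e0).
    - by move=> t /e1 /dg [].
    - by rewrite in_itv /= oppr_lt0 e0.
    - by move=> t /e1 /He[_]; rewrite /= line0.
  have [] : is_derive (0 : R) 1 (w \o line) ('D_v w (line 0)).
    by apply: dg; rewrite normr0.
  by rewrite line0 => _ <- _ ->.
split=> //; rewrite leNgt; apply/negP => c0.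
have : \forall h \near 0^',
    0 < h^-1 *: (('D_v w \o line) (h *: 1 + 0) - ('D_v w \o line) 0).
  have [] : is_derive (0 : R) 1 ('D_v w \o line) ('D_v ('D_v w) (line 0)).
    by apply: derive_line; rewrite line0.
  rewrite line0 => dk Dk; apply: cvgr_gt c0; rewrite -Dk; exact: dk.
move=> /nbhs_ballP[d /= d0 Hd]; clear ddw.
have kpos t : 0 < t -> t < d -> 0 < 'D_v w (line t).
  move=> t0 td; have := Hd t; rewrite /ball /= sub0r normrN gtr0_norm// => /(_ td).
  rewrite gt_eqF// => /(_ isT); rewrite line0 Dw0 subr0 addr0 [t *: 1]mulr1.
  by rewrite pmulr_rgt0 ?invr_gt0.
pose t := Num.min d e / 2.
have m0 : 0 < Num.min d e by rewrite lt_min d0 e0.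
have t0 : 0 < t by rewrite divr_gt0.
have tm : t < Num.min d e by rewrite ltr_pdivrMr// ltr_pMr// ltr1n.
have [td te] : t < d /\ t < e by move: tm; rewrite lt_min => /andP[].
have [||c] := @MVT R (w \o line) (fun s => 'D_v w (line s)) 0 t t0.
- move=> s; rewrite in_itv /= => /andP[s0 st]; apply: dg.
  by rewrite gtr0_norm// (lt_trans st).
- apply: continuous_in_subspaceT => s; rewrite inE /= in_itv /= => /andP[s0 st].
  have : differentiable (w \o line) s.
    by apply/derivable1_diffP; case: (dg s); rewrite // ger0_norm// (le_lt_trans st).
  exact: differentiable_continuous.
- rewrite in_itv /= => /andP[c0' ct] H.
  have : 0 < 'D_v w (line c) * (t - 0).
    by rewrite subr0 mulr_gt0// kpos// (lt_trans ct).
  rewrite -H subr_gt0 /= line0 ltNge.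
  by have [] := He t; rewrite ?gtr0_norm// => _ ->.
Unshelve. all: by end_near. Qed.

End SecondDerivative.

(** * The elliptic maximum principle *)

Definition partial (R : realType) (n : nat) (j : 'I_n) (u : 'rV[R]_n -> R) :
    'rV[R]_n -> R := 'D_(delta_mx 0 j) u.

Definition elliptic (R : realType) (n : nat) (a : 'rV[R]_n -> 'M[R]_n)
    (b : 'rV[R]_n -> 'I_n -> R) (u : 'rV[R]_n -> R) (z : 'rV[R]_n) : R :=
  \sum_i \sum_j a z i j * partial i (partial j u) z
  + \sum_j b z j * partial j u z.

(** Enough to compute second derivatives along lines from the partial ones;
    continuity of the latter is not required. *)
Definition twice_differentiable (R : realType) (n : nat) (u : 'rV[R]_n -> R)
    (z : 'rV[R]_n) : Prop :=
  (\forall y \near z, differentiable u y) /\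
  forall j, differentiable (partial j u) z.

Section Elliptic.
Context (R : realType) (n : nat).
Implicit Types (u h : 'rV[R]_n -> R) (z v : 'rV[R]_n).

Lemma derive_partial u z v :
  differentiable u z -> 'D_v u z = \sum_j v 0 j * partial j u z.
Proof.
move=> du; rewrite deriveE// {1}(row_sum_delta v) linear_sum /=.
by apply: eq_bigr => j _; rewrite linearZ /= /partial deriveE.
Qed.

Lemma derive_derive_partial u z v : twice_differentiable u z ->
  derivable ('D_v u) z v /\
  'D_v ('D_v u) z = \sum_i \sum_j v 0 i * v 0 j * partial i (partial j u) z.
Proof.
move=> [du ddu].
have e : \near z, (\sum_j v 0 j *: partial j u) z = 'D_v u z.
  near=> y; rewrite fct_sumE derive_partial//; last by near: y.
have d j : derivable (v 0 j *: partial j u) z v.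
  by apply: derivableZ; exact: diff_derivable.
split; first by apply: near_eq_derivable e _; exact: derivable_sum.
rewrite -(near_eq_derive _ e) derive_sum//.
rewrite exchange_big; apply: eq_bigr => j _.
rewrite deriveZ; last exact: diff_derivable.
rewrite derive_partial// scaler_sumr; apply: eq_bigr => i _.
by rewrite /GRing.scale /= mulrCA mulrA.
Unshelve. all: by end_near. Qed.

(** Writing [a z] as [L L^T] turns the second order part into a sum of second
    derivatives along the columns of [L]. *)
Lemma elliptic_max_le0 a b u z :
  positive_definite (a z) -> twice_differentiable u z ->
  (\forall y \near z, u y <= u z) -> elliptic a b u z <= 0.
Proof.
move=> pa tu umax; have [du ddu] := tu.
have D0 v : 'D_v u z = 0 /\ 'D_v ('D_v u) z <= 0.
  by apply: derive_max => //; exact: (derive_derive_partial v tu).1.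
rewrite /elliptic [X in _ + X]big1 ?addr0 => [|j _]; last first.
  by rewrite /partial (D0 _).1 mulr0.
apply: trace_positive_le0 => // v.
by rewrite -(derive_derive_partial v tu).2; exact: (D0 v).2.
Qed.

Lemma partialDZ u h (e : R) z j :
  differentiable u z -> differentiable h z ->
  partial j (u + e *: h) z = partial j u z + e * partial j h z.
Proof.
move=> /diff_derivable du /diff_derivable dh; rewrite /partial deriveD//.
- by rewrite deriveZ.
- exact: derivableZ.
Qed.

Lemma partialZ u (e : R) z j :
  differentiable u z -> partial j (e *: u) z = e * partial j u z.
Proof. by move=> /diff_derivable du; rewrite /partial deriveZ. Qed.

Lemma partialM u h z j : differentiable u z -> differentiable h z ->
  partial j (u * h) z = u z * partial j h z + h z * partial j u z.
Proof. by move=> /diff_derivable du /diff_derivable dh; exact: deriveM. Qed.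

Lemma partial_cst (c : R) z j : partial j (cst c) z = 0.
Proof. exact: derive_cst. Qed.

Lemma near_partialDZ u h (e : R) z j :
  twice_differentiable u z -> twice_differentiable h z ->
  \near z, (partial j u + e *: partial j h) z = partial j (u + e *: h) z.
Proof.
move=> [du _] [dh _]; near=> y; rewrite partialDZ//.
- by near: y.
- by near: y.
Unshelve. all: by end_near. Qed.

Lemma near_eq_differentiable (V W : normedModType R) (f g : V -> W) x :
  (\near x, f x = g x) -> differentiable f x -> differentiable g x.
Proof.
move=> fg df.
have dg : g \o shift x = cst (g x) + 'd f x +o_ 0 id.
  apply/eqaddoP => _/posnumP[e].
  have /eqaddoP/(_ e%:num) := diff_locally df.
  move=> /(_ [gt0 of e%:num]); apply: filter_app.
  have := fg; rewrite (near_shift 0 x) subr0 /=.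
  apply: filter_app; near=> y => yfg.
  by rewrite /= !fctE /= -(nbhs_singleton fg) -yfg.
have dC := diff_continuous df.
apply/diff_locallyP; rewrite (diff_unique dC dg).
by split.
Unshelve. all: by end_near. Qed.

Lemma twice_differentiableDZ u h (e : R) z :
  twice_differentiable u z -> twice_differentiable h z ->
  twice_differentiable (u + e *: h) z.
Proof.
move=> tu th; split.
  have [du _] := tu; have [dh _] := th; near=> y.
  by apply: differentiableD; [|apply: differentiableZ]; near: y.
move=> j; apply: near_eq_differentiable (near_partialDZ e j tu th) _.
by apply: differentiableD; [exact: tu.2|apply: differentiableZ; exact: th.2].
Unshelve. all: by end_near. Qed.

Lemma ellipticDZ a b u h (e : R) z :
  twice_differentiable u z -> twice_differentiable h z ->
  elliptic a b (u + e *: h) z = elliptic a b u z + e * elliptic a b h z.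
Proof.
move=> tu th; rewrite /elliptic mulrDr addrACA; congr (_ + _).
  rewrite mulr_sumr -big_split; apply: eq_bigr => i _.
  rewrite mulr_sumr -big_split; apply: eq_bigr => j _ /=.
  rewrite {1}/partial -(near_eq_derive _ (near_partialDZ e j tu th)).
  have := partialDZ e i (tu.2 j) (th.2 j); rewrite {1}/partial => ->.
  by rewrite mulrDr (mulrCA e).
rewrite mulr_sumr -big_split; apply: eq_bigr => j _ /=.
have /nbhs_singleton du := tu.1; have /nbhs_singleton dh := th.1.
by rewrite partialDZ// mulrDr (mulrCA e).
Qed.

End Elliptic.

Lemma continuous_at_sum (R : realType) (T : topologicalType) (I : finType)
    (F : I -> T -> R) (x : T) :
  (forall i, {for x, continuous (F i)}) ->
  {for x, continuous (fun z => \sum_i F i z)}.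
Proof.
move=> FC; apply: cvg_big => [ab|i _]; last exact: FC.
by apply: cvgD; [exact: cvg_fst|exact: cvg_snd].
Qed.

Lemma continuous_atD (R : realType) (T : topologicalType) (f g : T -> R) x :
  {for x, continuous f} -> {for x, continuous g} ->
  {for x, continuous (fun z => f z + g z)}.
Proof. by move=> fC gC; apply: cvgD. Qed.

Lemma continuous_atM (R : realType) (T : topologicalType) (f g : T -> R) x :
  {for x, continuous f} -> {for x, continuous g} ->
  {for x, continuous (fun z => f z * g z)}.
Proof. by move=> fC gC; apply: cvgM. Qed.

Section Barrier.
Context (R : realType) (n : nat).
Variables (nu z0 : 'rV[R]_n) (K : R).
Implicit Types (z v : 'rV[R]_n) (i j : 'I_n).

(** With [w = z - z0], this is [2 <nu, w> - 2 |w|^2], positive exactly in the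
    euclidean ball of diameter [nu] based at [z0]: half the size of the ball
    centered at [z0 + nu] with [z0] on its boundary, so that the closure of the
    small ball lies inside the large one, up to the point [z0]. *)
Definition cap z : R :=
  \sum_i (2 * nu 0 i * (z 0 i - z0 0 i) - 2 * (z 0 i - z0 0 i) ^+ 2).

(** The quadratic term makes the second derivative in the direction [nu] as
    large as desired. *)
Definition barrier z : R := cap z + K * cap z ^+ 2.

Lemma differentiable_shifted_entry i z :
  differentiable (fun y : 'rV[R]_n => y 0 i - z0 0 i : R) z.
Proof. by apply: differentiableB; first exact: differentiable_coord. Qed.

Lemma partial_shifted_entry i j z :
  partial j (fun y : 'rV[R]_n => y 0 i - z0 0 i : R) z = (i == j)%:R.
Proof.
rewrite /partial /derive; apply: cvg_lim => //; apply: cvg_near_cst.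
near=> h; have h0 : h != 0 by near: h; exact: nbhs_dnbhs_neq.
rewrite /= !mxE /= opprB addrA subrK addrK /GRing.scale /=.
by rewrite mulrA mulVf// mul1r.
Unshelve. all: by end_near. Qed.

Let cap_term i : 'rV[R]_n -> R := fun z =>
  2 * nu 0 i * (z 0 i - z0 0 i) - 2 * (z 0 i - z0 0 i) ^+ 2.

Let cap_termE i : cap_term i =
  (2 * nu 0 i) *: (fun z => z 0 i - z0 0 i : R)
  + (- 2) *: ((fun z => z 0 i - z0 0 i : R) * (fun z => z 0 i - z0 0 i : R)).
Proof. by apply/funext => z; rewrite /cap_term expr2 -mulNr. Qed.

Let capE : cap = \sum_i cap_term i.
Proof. by apply/funext => z; rewrite fct_sumE. Qed.

Let differentiable_cap_term i z : differentiable (cap_term i) z.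
Proof.
have d := differentiable_shifted_entry i z.
rewrite cap_termE; apply: differentiableD; apply: differentiableZ => //.
exact: differentiableM.
Qed.

Lemma differentiable_cap z : differentiable cap z.
Proof. by rewrite capE; apply: differentiable_sum. Qed.

Lemma partial_cap j : partial j cap = fun z => 2 * nu 0 j - 4 * (z 0 j - z0 0 j).
Proof.
apply/funext => z; rewrite capE /partial derive_sum => [|i]; last first.
  exact: diff_derivable.
have Dt i : 'D_(delta_mx 0 j) (cap_term i) z
    = (i == j)%:R * (2 * nu 0 i - 4 * (z 0 i - z0 0 i)).
  have d := differentiable_shifted_entry i z.
  rewrite cap_termE [LHS]partialDZ; last exact: differentiableM.
    rewrite partialZ// partialM// partial_shifted_entry; ring.
  exact: differentiableZ.
rewrite (bigD1 j)//= Dt eqxx mul1r big1 ?addr0// => i ij.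
by rewrite Dt (negbTE ij) mul0r.
Qed.

Let partial_capE j :
  partial j cap = cst (2 * nu 0 j) + (- 4) *: (fun z => z 0 j - z0 0 j : R).
Proof. by apply/funext => z; rewrite partial_cap -mulNr. Qed.

Lemma differentiable_partial_cap j z : differentiable (partial j cap) z.
Proof.
rewrite partial_capE; apply: differentiableD => //; apply: differentiableZ.
exact: differentiable_shifted_entry.
Qed.

Lemma partial_partial_cap i j z : partial i (partial j cap) z = - 4 * (i == j)%:R.
Proof.
have d := differentiable_shifted_entry j z.
rewrite partial_capE partialDZ// partial_cst partial_shifted_entry add0r.
by rewrite eq_sym.
Qed.

Let barrierE : barrier = cap + K *: (cap * cap).
Proof. by apply/funext => z; rewrite /barrier expr2. Qed.

Lemma differentiable_barrier z : differentiable barrier z.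
Proof.
have d := differentiable_cap z.
rewrite barrierE; apply: differentiableD => //.
by apply: differentiableZ; exact: differentiableM.
Qed.

Lemma partial_barrier j :
  partial j barrier = fun z => (1 + 2 * K * cap z) * partial j cap z.
Proof.
apply/funext => z; have d := differentiable_cap z.
rewrite barrierE partialDZ//; last exact: differentiableM.
by rewrite partialM//; move: (partial j cap z) => D; ring.
Qed.

Let partial_barrierE j :
  partial j barrier = (cst 1 + (2 * K) *: cap) * partial j cap.
Proof. by rewrite partial_barrier. Qed.

Lemma twice_differentiable_barrier z : twice_differentiable barrier z.
Proof.
split=> [|j]; first by near=> y; exact: differentiable_barrier.
rewrite partial_barrierE; apply: differentiableM.
  apply: differentiableD => //.
  by apply: differentiableZ; exact: differentiable_cap.
exact: differentiable_partial_cap.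
Unshelve. all: by end_near. Qed.

Lemma partial_partial_barrier i j z : partial i (partial j barrier) z =
  2 * K * (partial i cap z * partial j cap z)
  - 4 * (i == j)%:R * (1 + 2 * K * cap z).
Proof.
have d := differentiable_cap z; have d' := differentiable_partial_cap j z.
have d1 : differentiable ((2 * K) *: cap) z by exact: differentiableZ.
have dc : differentiable (cst 1 : 'rV[R]_n -> R) z by [].
have := partialDZ (2 * K) i dc d; rewrite partial_cst => dE.
have dd : differentiable (cst 1 + (2 * K) *: cap) z by exact: differentiableD.
rewrite partial_barrierE (partialM i dd d') dE partial_partial_cap !fctE /GRing.scale /=.
move: (partial i cap z) (partial j cap z) (i == j)%:R => D D' e; ring.
Qed.

(** The quantity assumed positive is the value of the operator at [z0],
    where the gradient of [cap] is [2 nu] and its Hessian is [- 4]. *)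
Lemma elliptic_barrier_gt0 (a : 'rV[R]_n -> 'M[R]_n) (b : 'rV[R]_n -> 'I_n -> R) :
  (forall i j, {for z0, continuous (fun z => a z i j : R)}) ->
  (forall j, {for z0, continuous (fun z => b z j : R)}) ->
  0 < 8 * K * (nu *m a z0 *m nu^T) 0 0
      - 4 * \tr (a z0) + 2 * \sum_j b z0 j * nu 0 j ->
  \forall z \near z0, 0 < elliptic a b barrier z.
Proof.
move=> aC bC pos.
have cap0 : cap z0 = 0.
  by rewrite /cap big1// => i _; rewrite !subrr expr0n /= !mulr0 subrr.
have capC : {for z0, continuous cap}.
  exact/differentiable_continuous/differentiable_cap.
have pcapC j : {for z0, continuous (partial j cap)}.
  exact/differentiable_continuous/differentiable_partial_cap.
have pcap0 j : partial j cap z0 = 2 * nu 0 j.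
  by rewrite partial_cap subrr mulr0 subr0.
have val : elliptic a b barrier z0 = 8 * K * (nu *m a z0 *m nu^T) 0 0
      - 4 * \tr (a z0) + 2 * \sum_j b z0 j * nu 0 j.
  rewrite /elliptic; congr (_ + _); last first.
    rewrite mulr_sumr; apply: eq_bigr => j _.
    by rewrite partial_barrier pcap0 cap0; ring.
  rewrite mxE /mxtrace !mulr_sumr -sumrN.
  rewrite [X in _ = X + _](_ : _ = \sum_i \sum_j 8 * K * (nu 0 i * a z0 i j * nu 0 j)).
    rewrite -big_split; apply: eq_bigr => i _ /=.
    rewrite (eq_bigr (fun j => 8 * K * (nu 0 i * a z0 i j * nu 0 j)
        + - 4 * (a z0 i j * (i == j)%:R))) => [|j _]; last first.
      by rewrite partial_partial_barrier !pcap0 cap0; ring.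
    rewrite big_split /=; congr (_ + _).
    rewrite (bigD1 i)//= eqxx big1 ?addr0 ?mulr1 ?mulNr// => j ji.
    by rewrite eq_sym (negbTE ji) !mulr0.
  rewrite exchange_big; apply: eq_bigr => j _ /=.
  by rewrite !mxE mulr_suml !mulr_sumr.
rewrite -val in pos.
suff ellC : {for z0, continuous (elliptic a b barrier)} by exact: (cvgr_gt _ ellC).
have capC1 : {for z0, continuous (fun z => 1 + 2 * K * cap z)}.
  apply: continuous_atD; first exact: cst_continuous.
  by apply: continuous_atM => //; exact: cst_continuous.
apply: continuous_atD; apply: continuous_at_sum => i; last first.
  rewrite partial_barrier; apply: continuous_atM; first exact: bC.
  exact: continuous_atM.
apply: continuous_at_sum => j; apply: continuous_atM; first exact: aC.
have -> : partial i (partial j barrier) = fun z =>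
    2 * K * (partial i cap z * partial j cap z)
    + (- (4 * (i == j)%:R)) * (1 + 2 * K * cap z).
  by apply/funext => z; rewrite partial_partial_barrier mulNr.
apply: continuous_atD; apply: continuous_atM => //; try exact: cst_continuous.
by apply: continuous_atM; exact: pcapC.
Qed.

End Barrier.

Section StrongMaximumPrinciple.
Context (R : realType) (n : nat).
Variables (U : set 'rV[R]_n) (a : 'rV[R]_n -> 'M[R]_n).
Variables (b : 'rV[R]_n -> 'I_n -> R) (u : 'rV[R]_n -> R) (m : R).
Hypothesis U_open : open U.
Hypothesis a_pos : forall z, U z -> positive_definite (a z).
Hypothesis a_cont :
  forall z i j, U z -> {for z, continuous (fun y => a y i j : R)}.
Hypothesis b_cont : forall z j, U z -> {for z, continuous (fun y => b y j : R)}.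
Hypothesis u_twice : forall z, U z -> twice_differentiable u z.
Hypothesis u_sub : forall z, U z -> 0 <= elliptic a b u z.
Hypothesis u_le : forall z, U z -> u z <= m.

Let u_cont z : U z -> {for z, continuous u}.
Proof.
by move=> /u_twice[/nbhs_singleton + _]; exact: differentiable_continuous.
Qed.

Let quad (v : 'rV[R]_n) : R := \sum_i v 0 i ^+ 2.

Let quadC (v w : 'rV[R]_n) : quad (v - w) = quad (w - v).
Proof. by apply: eq_bigr => i _; rewrite !mxE -sqrrN opprB. Qed.

Let quad_cont (c z : 'rV[R]_n) :
  {for z, continuous (fun y : 'rV[R]_n => quad (y - c))}.
Proof.
have -> : (fun y : 'rV[R]_n => quad (y - c))
    = fun y => \sum_i (y 0 i - c 0 i) * (y 0 i - c 0 i).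
  by apply/funext => y; apply: eq_bigr => i _; rewrite !mxE expr2.
apply: continuous_at_sum => i.
have C : {for z, continuous (fun y : 'rV[R]_n => y 0 i - c 0 i : R)}.
  exact/differentiable_continuous/differentiable_shifted_entry.
exact: (continuous_atM C C).
Qed.

Let norm_sqr_le_quad v : `|v| ^+ 2 <= quad v.
Proof.
have [->|v0] := eqVneq `|v| 0.
  by rewrite expr0n /= sumr_ge0// => i _; exact: sqr_ge0.
have [[k i] /= vE] := mx_norm_neq0 (v0 : mx_norm v != 0).
have {vE} vE : `|v| = `|v k i| by [].
rewrite vE real_normK ?num_real// ord1 /quad (bigD1 i)//=.
by rewrite lerDl sumr_ge0// => j _; exact: sqr_ge0.
Qed.

Let closed_ball_compact (z0 : 'rV[R]_n) (r : {posnum R}) :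
  compact (closed_ball z0 r%:num).
Proof.
apply: bounded_closed_compact; last exact: closed_ball_closed.
exists (`|z0| + r%:num); split; first exact: num_real.
move=> M Mlt z; rewrite closed_ballE// /closed_ball_ /= => zr.
apply: le_trans (ltW Mlt); rewrite -[X in `|X|](subKr z0 z).
by rewrite (le_trans (ler_normB _ _))// lerD2l.
Qed.

(** Hopf's argument.  The hypothesis says that [u < m] in the open ball centered
    at [z0 + nu] whose boundary passes through the contact point [z0] of [u] with
    its maximum.  On a small ball around [z0], the barrier is negative on the part
    of the boundary sphere where [u] may come close to [m].  So a small multiple
    of the barrier added to [u] produces an interior maximum, where the elliptic
    operator would have to be nonpositive. *)
Lemma no_touching_ball (z0 nu : 'rV[R]_n) :
  U z0 -> u z0 = m -> nu != 0 ->
  (forall z, U z -> 0 < cap nu z0 z + quad (z - z0) -> u z < m) -> False.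
Proof.
move=> Uz0 uz0 nu0 touch.
pose A := (nu *m a z0 *m nu^T) 0 0.
have A0 : 0 < A by exact: (a_pos Uz0).2.
pose C := - 4 * \tr (a z0) + 2 * \sum_j b z0 j * nu 0 j.
(* makes the value [8 K A + C] of the operator at [z0] at least [8 A] *)
pose K := `|C| / (8 * A) + 1.
have K0 : 0 < K by rewrite ltr_wpDl// divr_ge0// mulr_ge0// ltW.
have cap0 : cap nu z0 z0 = 0.
  by rewrite /cap big1// => i _; rewrite !subrr expr0n /= !mulr0 subrr.
set h := barrier nu z0 K.
have h0 : h z0 = 0 by rewrite /h /barrier cap0 expr0n mulr0 addr0.
have capC z : {for z, continuous (cap nu z0)}.
  exact/differentiable_continuous/differentiable_cap.
have hC z : {for z, continuous h}.
  exact/differentiable_continuous/differentiable_barrier.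
have near_h : \forall z \near z0, 0 < elliptic a b h z.
  apply: elliptic_barrier_gt0 => [i j|j|]; [exact: a_cont|exact: b_cont|].
  rewrite -/A -addrA -mulNr -/C.
  have -> : 8 * K * A = `|C| + 8 * A by rewrite /K; field; rewrite gt_eqF.
  by have := ler_norm (- C); rewrite normrN; lra.
have near_cap : \forall z \near z0, 0 < 1 + K * cap nu z0 z.
  have CC : {for z0, continuous (fun z => 1 + K * cap nu z0 z)}.
    apply: continuous_atD; first exact: cst_continuous.
    by apply: continuous_atM => //; exact: cst_continuous.
  by apply: (cvgr_gt _ CC); rewrite cap0 mulr0 addr0.
have near_U : \forall z \near z0, U z by exact: open_nbhs_nbhs.
have [r Br] : exists r : {posnum R}, closed_ball z0 r%:num `<=`
    [set z | [/\ U z, 0 < elliptic a b h z & 0 < 1 + K * cap nu z0 z]].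
  by apply/nbhs_closedballP; near=> z; split; near: z.
set B := closed_ball z0 r%:num in Br.
have BE z : B z = (`|z0 - z| <= r%:num) by rewrite /B closed_ballE.
have B0 : B z0 by rewrite BE subrr normr0.
have Bcompact : compact B := @closed_ball_compact z0 r.
have distC (z : 'rV[R]_n) : {for z, continuous (fun y : 'rV[R]_n => `|z0 - y|)}.
  apply: (@continuous_comp _ _ _ (fun y : 'rV[R]_n => z0 - y) (@Num.norm R _)).
    by apply: continuousB; [exact: cst_continuous|exact: cvg_id].
  exact: norm_continuous.
have [c1 _ c1max] : exists2 c, c \in B & forall z, z \in B -> h z <= h c.
  apply: EVT_max_rV => //; first by exists z0.
  by apply: continuous_subspaceT => z; exact: hC.
have c1ge0 : 0 <= h c1 by rewrite -h0 c1max// inE.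
(* the largest boundary value of [u] over the compact part of the sphere where
   the barrier is nonnegative leaves room below [m] *)
have [e e0 eB] : exists2 e : R, 0 < e &
    forall z, B z -> `|z0 - z| = r%:num -> u z + e * h z < m.
  pose S := B `&` ([set z | `|z0 - z| = r%:num] `&` [set z | 0 <= cap nu z0 z]).
  have outside e z : 0 < e -> B z -> cap nu z0 z < 0 -> u z + e * h z < m.
    move=> e0 Bz cz; have [Uz _ capz] := Br _ Bz.
    have -> : h z = cap nu z0 z * (1 + K * cap nu z0 z) by rewrite /h /barrier; ring.
    rewrite -[ltRHS]addr0 ler_ltD ?u_le// pmulr_rlt0// nmulr_rlt0//.
  have [[s Ss]|noS] := pselect (exists s, S s); last first.
    exists 1 => // z Bz zr; apply: outside => //.
    by rewrite ltNge; apply/negP => cz; apply: noS; exists z.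
  have Scompact : compact S.
    apply: compact_closedI => //; apply: closedI.
      rewrite (_ : mkset _
          = (fun z : 'rV[R]_n => `|z0 - z|) @^-1` [set x : R | x = r%:num])//.
      by apply: preimage_closed => [z _|]; [exact: distC|exact: closed_eq].
    rewrite (_ : mkset _ = cap nu z0 @^-1` [set x : R | 0 <= x])//.
    by apply: preimage_closed => [z _|]; [exact: capC|exact: closed_ge].
  have [c2 + c2max] : exists2 c, c \in S & forall z, z \in S -> u z <= u c.
    apply: EVT_max_rV => //; first by exists s.
    apply: continuous_in_subspaceT => z; rewrite inE => -[Bz _].
    by apply: u_cont; case: (Br _ Bz).
  rewrite inE => -[Bc2 [c2r c2cap]].
  have uc2 : u c2 < m.
    apply: touch; first by case: (Br _ Bc2).
    apply: ltr_wpDl => //; apply: lt_le_trans (norm_sqr_le_quad _).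
    by rewrite -[c2 - z0]opprB normrN c2r exprn_gt0.
  have h1 : 0 < h c1 + 1 by rewrite ltr_wpDl.
  exists ((m - u c2) / (h c1 + 1)) => [|z Bz zr].
    by rewrite divr_gt0// subr_gt0.
  have [cz|cz] := leP 0 (cap nu z0 z); last first.
    by apply: outside => //; rewrite divr_gt0// subr_gt0.
  have uz : u z <= u c2 by apply: c2max; rewrite inE.
  have hz : h z <= h c1 by apply: c1max; rewrite inE.
  suff : (m - u c2) / (h c1 + 1) * h z < m - u c2 by lra.
  rewrite mulrAC ltr_pdivrMr// ltr_pM2l ?subr_gt0//; lra.
pose w := u + e *: h.
have wE z : w z = u z + e * h z by [].
have [zm zmB wmax] : exists2 c, c \in B & forall z, z \in B -> w z <= w c.
  apply: EVT_max_rV => //; first by exists z0.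
  apply: continuous_in_subspaceT => z; rewrite inE => Bz.
  apply: continuous_atD; first by apply: u_cont; case: (Br _ Bz).
  by apply: (@continuous_atM _ _ (cst e) h) => //; exact: cst_continuous.
rewrite inE in zmB.
have wm : m <= w zm.
  by have := wmax z0; rewrite wE h0 mulr0 addr0 uz0 => -> //; rewrite inE.
have zmr : `|z0 - zm| < r%:num.
  have := zmB; rewrite BE le_eqVlt => /orP[/eqP zmr|//].
  by have := eB _ zmB zmr; rewrite -wE ltNge wm.
have [Uzm Lh _] := Br _ zmB.
have th := twice_differentiable_barrier nu z0 K zm.
have := elliptic_max_le0 b (a_pos Uzm) (twice_differentiableDZ e (u_twice Uzm) th).
have near_max : \forall y \near zm, w y <= w zm.
  have : \forall y \near zm, `|z0 - y| < r%:num by exact: (cvgr_lt _ (distC zm)).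
  by apply: filterS => y yr; apply: wmax; rewrite inE BE ltW.
move=> /(_ near_max); rewrite ellipticDZ//; last exact: u_twice.
rewrite leNgt => /negP; apply.
by rewrite ltr_wpDl ?u_sub// mulr_gt0.
Unshelve. all: by end_near. Qed.

(** A zero of [m - u] adjacent to the region where [u < m] can be reached by a
    ball inside that region: take the point of contact nearest to a center
    chosen close enough. *)
Lemma strong_maximum_principle (z0 : 'rV[R]_n) :
  U z0 -> u z0 = m -> \forall z \near z0, u z = m.
Proof.
move=> Uz0 uz0.
have [r rU] : exists r : {posnum R}, closed_ball z0 r%:num `<=` U.
  by apply/nbhs_closedballP; exact: open_nbhs_nbhs.
set B := closed_ball z0 r%:num in rU.
have B0 : B z0 by exact: closed_ballxx.
have Bcompact : compact B := @closed_ball_compact z0 r.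
pose S := B `&` [set z | u z = m].
have Scompact : compact S.
  apply: subclosed_compact Bcompact _ => [z Sz|z []//].
  have Bz : B z.
    apply: closed_ball_closed => W Wz.
    by have [y [[By _] Wy]] := Sz W Wz; exists y.
  split=> //=; apply/eqP/negPn/negP => uz.
  have {}uz : u z < m by rewrite lt_neqAle uz u_le//; exact: rU.
  have : \forall y \near z, u y < m by exact: (cvgr_lt _ (u_cont (rU _ Bz))).
  by move=> /Sz[y [[_ /= ->]]]; rewrite ltxx.
apply: contrapT => notm.
have near_quad : \forall y \near z0, quad (y - z0) < (r%:num / 2) ^+ 2.
  apply: (cvgr_lt _ (@quad_cont z0 z0)).
  by rewrite subrr /quad big1 ?exprn_gt0// => i _; rewrite mxE expr0n.
have [y0 yr uy0] : exists2 y0, quad (y0 - z0) < (r%:num / 2) ^+ 2 & u y0 != m.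
  apply: contrapT => none; apply: notm; apply: filterS near_quad => y yr.
  by apply: contrapT => uy; apply: none; exists y => //; apply/eqP.
have [z1 z1S z1min] : exists2 z1, z1 \in S &
    forall z, z \in S -> quad (z1 - y0) <= quad (z - y0).
  apply: (@EVT_min_rV _ _ (fun z => quad (z - y0))) => //; first by exists z0.
  by apply: continuous_subspaceT => z; exact: quad_cont.
move: (z1S); rewrite inE => -[Bz1 /= uz1].
apply: (@no_touching_ball z1 (y0 - z1)) => //.
- exact: rU.
- by rewrite subr_eq0; apply: contra uy0 => /eqP ->; rewrite uz1.
move=> z Uz pos.
have lt1 : quad (z - y0) < quad (z1 - y0).
  rewrite -subr_gt0; congr (0 < _) : pos.
  rewrite /cap /quad -sumrB -big_split; apply: eq_bigr => i _.
  by rewrite /= !mxE; ring.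
have lt2 : quad (z - y0) < (r%:num / 2) ^+ 2.
  by rewrite (lt_le_trans lt1)// (le_trans (z1min z0 _)) ?inE// quadC ltW.
have half v : quad v < (r%:num / 2) ^+ 2 -> `|v| < r%:num / 2.
  by move=> /(le_lt_trans (norm_sqr_le_quad v)); rewrite ltr_pXn2r// nnegrE.
have Bz : B z.
  rewrite /B closed_ballE// /closed_ball_ /=.
  have -> : z0 - z = (z0 - y0) - (z - y0) by rewrite opprB addrA subrK.
  rewrite (le_trans (ler_normB _ _))// [leRHS]splitr.
  by apply: lerD; apply/ltW/half => //; rewrite quadC.
rewrite lt_neqAle u_le// andbT; apply/eqP => uz.
by move: lt1; rewrite ltNge z1min// inE.
Qed.

End StrongMaximumPrinciple.

(** * Continuously differentiable functions *)

Lemma near_eq_continuous (T U : topologicalType) (f g : T -> U) x :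
  (\near x, f x = g x) -> {for x, continuous f} -> {for x, continuous g}.
Proof.
move=> fg fC; rewrite /prop_for /continuous_at -(nbhs_singleton fg).
exact: cvg_trans (near_eq_cvg fg) fC.
Qed.

Section ContinuouslyDifferentiable.
Context (R : realType) (V : normedModType R) (U : set V).
Hypothesis U_open : open U.
Implicit Types f g : V -> R.

Let near_U x : U x -> \forall y \near x, U y.
Proof. by move=> Ux; exact: open_nbhs_nbhs. Qed.

Lemma class_C1_continuous f x : class_C 1 U f -> U x -> {for x, continuous f}.
Proof. by move=> [df _] /df; exact: differentiable_continuous. Qed.

Lemma class_C1_derive_continuous f v x : class_C 1 U f -> U x ->
  {for x, continuous (fun y => 'D_v f y)}.
Proof. by move=> [_ ]; exact. Qed.

Lemma class_C1_cst (c : R) : class_C 1 U (fun _ : V => c).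
Proof.
split=> // v x Ux.
have -> : (fun y => 'D_v (fun _ : V => c) y) = fun=> 0.
  by apply/funext => y; exact: derive_cst.
exact: cst_continuous.
Qed.

Lemma class_C1D f g : class_C 1 U f -> class_C 1 U g ->
  class_C 1 U (fun x => f x + g x).
Proof.
move=> Cf Cg; split=> [x Ux|v x Ux].
  by apply: differentiableD; [exact: Cf.1|exact: Cg.1].
have e : \near x, 'D_v f x + 'D_v g x = 'D_v (f + g) x.
  near=> y; have Uy : U y by near: y; exact: near_U.
  by rewrite deriveD//; apply: diff_derivable; [exact: Cf.1|exact: Cg.1].
apply: near_eq_continuous e _.
by apply: continuous_atD; exact: class_C1_derive_continuous.
Unshelve. all: by end_near. Qed.

Lemma class_C1M f g : class_C 1 U f -> class_C 1 U g ->
  class_C 1 U (fun x => f x * g x).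
Proof.
move=> Cf Cg; split=> [x Ux|v x Ux].
  by apply: differentiableM; [exact: Cf.1|exact: Cg.1].
have e : \near x, f x * 'D_v g x + g x * 'D_v f x = 'D_v (f * g) x.
  near=> y; have Uy : U y by near: y; exact: near_U.
  by rewrite deriveM//; apply: diff_derivable; [exact: Cf.1|exact: Cg.1].
apply: near_eq_continuous e _.
have Cf0 := class_C1_continuous Cf Ux; have Cg0 := class_C1_continuous Cg Ux.
have Cf1 := @class_C1_derive_continuous f v x Cf Ux.
have Cg1 := @class_C1_derive_continuous g v x Cg Ux.
exact: (continuous_atD (continuous_atM Cf0 Cg1) (continuous_atM Cg0 Cf1)).
Unshelve. all: by end_near. Qed.

Lemma class_C1V f : (forall x, U x -> f x != 0) -> class_C 1 U f ->
  class_C 1 U (fun x => (f x)^-1).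
Proof.
move=> f0 Cf; split=> [x Ux|v x Ux].
  by apply: differentiableV; [exact: Cf.1|exact: f0].
have e : \near x, - ((f x)^-1 * (f x)^-1) * 'D_v f x = 'D_v (fun x => (f x)^-1) x.
  near=> y; have Uy : U y by near: y; exact: near_U.
  rewrite deriveV ?f0//; last by apply: diff_derivable; exact: Cf.1.
  by rewrite /GRing.scale /= -expr2 exprVn.
apply: near_eq_continuous e _.
apply: continuous_atM; last exact: class_C1_derive_continuous.
have fVC : {for x, continuous (fun y => (f y)^-1)}.
  by apply: cvgV; [exact: f0|exact: class_C1_continuous Ux].
by apply: continuousN; exact: continuous_atM.
Unshelve. all: by end_near. Qed.

Lemma class_C1_sum (I : Type) (r : seq I) (P : pred I) (F : I -> V -> R) :
  (forall i, class_C 1 U (F i)) ->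
  class_C 1 U (fun x => \sum_(i <- r | P i) F i x).
Proof.
move=> CF; elim: r => [|i r IH].
  by under eq_fun do rewrite big_nil; exact: class_C1_cst.
under eq_fun do rewrite big_cons; case: (P i); last exact: IH.
exact: (@class_C1D (F i) _ (CF i) IH).
Qed.

Lemma class_C1_prod (I : Type) (r : seq I) (P : pred I) (F : I -> V -> R) :
  (forall i, class_C 1 U (F i)) ->
  class_C 1 U (fun x => \prod_(i <- r | P i) F i x).
Proof.
move=> CF; elim: r => [|i r IH].
  by under eq_fun do rewrite big_nil; exact: class_C1_cst.
under eq_fun do rewrite big_cons; case: (P i); last exact: IH.
exact: (@class_C1M (F i) _ (CF i) IH).
Qed.

Lemma class_C1_det n (A : V -> 'M[R]_n) :
  (forall i j, class_C 1 U (fun x => A x i j)) ->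
  class_C 1 U (fun x => \det (A x)).
Proof.
move=> CA; apply: class_C1_sum => s; apply: class_C1M; first exact: class_C1_cst.
exact: class_C1_prod.
Qed.

Lemma class_C1_adj n (A : V -> 'M[R]_n) i j :
  (forall i j, class_C 1 U (fun x => A x i j)) ->
  class_C 1 U (fun x => (\adj (A x)) i j).
Proof.
move=> CA; under eq_fun do rewrite mxE /cofactor.
apply: class_C1M; first exact: class_C1_cst.
by apply: class_C1_det => k l; under eq_fun do rewrite !mxE; exact: CA.
Qed.

End ContinuouslyDifferentiable.

(** * Restriction to a linear subspace *)

Section LinearRestriction.
Context (R : realType) (m n : nat) (E : 'M[R]_(m, n)).
Implicit Types (F : 'rV[R]_n -> R) (z v : 'rV[R]_m).

Lemma differentiable_mulmxr z : differentiable (fun z : 'rV[R]_m => z *m E) z.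
Proof.
have -> : (fun z : 'rV[R]_m => z *m E) = \sum_j (fun z : 'rV[R]_m => z 0 j *: row j E).
  by apply/funext => y; rewrite fct_sumE mulmx_sum_row.
apply: differentiable_sum => j; apply: differentiableZl.
exact: differentiable_coord.
Qed.

Lemma continuous_mulmxr : continuous (fun z : 'rV[R]_m => z *m E).
Proof. by move=> z; exact/differentiable_continuous/differentiable_mulmxr. Qed.

Lemma derive_mulmxr F z v :
  'D_v (fun z => F (z *m E)) z = 'D_(v *m E) F (z *m E).
Proof.
rewrite /derive.
suff -> : (fun h : R =>
      h^-1 *: (((fun z => F (z *m E)) \o shift z) (h *: v) - F (z *m E)))
    = fun h => h^-1 *: ((F \o shift (z *m E)) (h *: (v *m E)) - F (z *m E)).
  by [].
by apply/funext => h /=; rewrite mulmxDl scalemxAl.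
Qed.

Lemma class_C1_mulmxr (W : set 'rV[R]_n) (U : set 'rV[R]_m) F :
  (forall z, U z -> W (z *m E)) ->
  class_C 1 W F -> class_C 1 U (fun z => F (z *m E)).
Proof.
move=> UW [dF CF]; split=> [z /UW Wz|v z /UW Wz].
  by apply: differentiable_comp; [exact: differentiable_mulmxr|exact: dF].
have e : \near z, 'D_(v *m E) F (z *m E) = 'D_v (fun z => F (z *m E)) z.
  by near=> y; rewrite derive_mulmxr.
apply: near_eq_continuous e _.
apply: (@continuous_comp _ _ _ (fun z => z *m E) (fun y => 'D_(v *m E) F y)).
  exact: continuous_mulmxr.
exact: CF.
Unshelve. all: by end_near. Qed.

Lemma twice_differentiable_mulmxr (W : set 'rV[R]_n) (U : set 'rV[R]_m) F z :
  open U -> (forall z, U z -> W (z *m E)) -> class_C 2 W F -> U z ->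
  twice_differentiable (fun z => F (z *m E)) z.
Proof.
move=> Uo UW [dF CF] Uz; split=> [|j].
  have : \forall y \near z, U y by exact: open_nbhs_nbhs.
  apply: filterS => y /UW Wy.
  by apply: differentiable_comp; [exact: differentiable_mulmxr|exact: dF].
have -> : partial j (fun z => F (z *m E)) =
    fun z => 'D_(delta_mx 0 j *m E) F (z *m E).
  by apply/funext => y; exact: derive_mulmxr.
have [dDF _] := CF (delta_mx 0 j *m E).
apply: (differentiable_comp (differentiable_mulmxr z)
  (g := fun y => 'D_(delta_mx 0 j *m E) F y)).
exact/dDF/UW.
Qed.

End LinearRestriction.

(** * The Laplace equation on a calibrated submanifold *)

Lemma pid_mx_section (R : realType) (p n : nat) : (p <= n)%N ->
  (pid_mx p : 'M[R]_(p, n)) *m (pid_mx p : 'M[R]_(n, p)) = 1%:M.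
Proof. by move=> pn; rewrite pid_mx_id// pid_mx_1. Qed.

Lemma pid_mx_coord_plane (R : realType) (p n : nat) (z : 'rV[R]_p) :
  coord_plane p (z *m pid_mx p : 'rV[R]_n).
Proof.
move=> i pi; rewrite mxE big1// => k _; rewrite mxE.
have -> : (k == i :> nat) = false by apply/eqP; have := ltn_ord k; lia.
by rewrite mulr0.
Qed.

Lemma coord_plane_pid_mxK (R : realType) (p n : nat) (y : 'rV[R]_n) :
  (p <= n)%N -> coord_plane p y -> y *m (pid_mx p : 'M[R]_(n, p)) *m pid_mx p = y.
Proof.
move=> pn yp; rewrite -mulmxA pid_mx_id//; apply/rowP => i; rewrite mxE.
rewrite (bigD1 i)//= mxE eqxx /= big1 ?addr0 => [|k ki]; last first.
  by rewrite mxE val_eqE (negbTE ki) mulr0.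
by case: ltnP => [_|/yp ->]; rewrite ?mulr1 ?mul0r.
Qed.

Section Calibrated.
Context (R : realType) (n p : nat) (X : calibrated_manifold R n p.+1).
Variables (M : set X) (O : set (chart R X n)).
Hypothesis M_phi : phi_submanifold M O.

Let E : 'M[R]_(p.+1, n) := pid_mx p.+1.

Definition induced_metric (c : chart R X n) (y : 'rV[R]_n) : 'M[R]_p.+1 :=
  E *m metric X c y *m E^T.

(** The volume density of [M] times the inverse of its metric: the coefficients
    of the Hodge star on one-forms.  The square of the density is the determinant
    of the metric, which allows this form, visibly smooth where the density does
    not vanish. *)
Definition star_coef (c : chart R X n) (y : 'rV[R]_n) : 'M[R]_p.+1 :=
  (calibration X c y E)^-1 *: \adj (induced_metric c y).

Section Pointwise.
Variables (c : chart R X n) (y : 'rV[R]_n).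
Hypothesis Oc : O c.
Hypothesis cy : cimg c y.
Hypothesis My : M (param c y).

Let c_adapted : adapted_chart p.+1 M c.
Proof. by case: M_phi => _ [sub _ _] _; exact: sub. Qed.

Let c_atlas : atlas c. Proof. by case: c_adapted. Qed.

Let pn : (p.+1 <= n)%N. Proof. by case: c_adapted. Qed.

Lemma param_in_chart : cdom c (param c y) /\ c (param c y) = y.
Proof. by case: cy => x cx <-; rewrite coordK. Qed.

Lemma metric_positive_definite : positive_definite (metric X c y).
Proof.
split; first exact: (Defs.metric_sym (metric X) c_atlas cy).
by move=> v v0; exact: (Defs.metric_pos (metric X) c_atlas cy v0).
Qed.

Lemma induced_metric_positive_definite : positive_definite (induced_metric c y).
Proof.
apply: (positive_definite_gram (F := pid_mx p.+1 : 'M[R]_(n, p.+1))).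
  exact: pid_mx_section.
exact: metric_positive_definite.
Qed.

Let S := induced_metric c y.

(** Rescaling the first vector of the coordinate frame gives a representative of
    the oriented unit tangent plane. *)
Lemma normalized_tangent_plane :
  phi_plane c y (set_row 0 ((Num.sqrt (\det S))^-1 *: row 0 E) E).
Proof.
have d0 : 0 < \det S.
  exact: positive_definite_det_gt0 induced_metric_positive_definite.
have s0 : 0 < (Num.sqrt (\det S))^-1 by rewrite invr_gt0 sqrtr_gt0.
have [cx cxy] := param_in_chart.
case: M_phi => _ _ /(_ c (param c y) _ Oc My cx); rewrite cxy; apply.
split; rewrite ?cxy.
  rewrite /unit_simple det_gram_set_rowZ -/(induced_metric c y) -/S.
  by rewrite exprVn sqr_sqrtr ?(ltW d0)// mulVf ?gt_eqF.
exists (set_row 0 ((Num.sqrt (\det S))^-1 *: row 0 1%:M) 1%:M).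
  by rewrite (alt_set_rowZ (@det_alternating R p.+1)) set_row_id det1 mulr1.
by rewrite -set_row_mul -scalemxAl -row_mul mul1mx.
Qed.

Lemma calibration_volume : calibration X c y E = Num.sqrt (\det S).
Proof.
have d0 : 0 < \det S.
  exact: positive_definite_det_gt0 induced_metric_positive_definite.
have [_] := normalized_tangent_plane.
rewrite (alt_set_rowZ (form_alt (calibration X) c_atlas cy)) set_row_id => h.
have s0 : Num.sqrt (\det S) != 0 by rewrite gt_eqF// sqrtr_gt0.
by rewrite -[LHS](mulVKf s0) h mulr1.
Qed.

Lemma form_eq0_tangent (sigma : Defs.form X p.+1) :
  (forall V, phi_plane c y V -> sigma c y V = 0) -> sigma c y E = 0.
Proof.
have d0 : 0 < \det S.
  exact: positive_definite_det_gt0 induced_metric_positive_definite.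
move=> /(_ _ normalized_tangent_plane).
rewrite (alt_set_rowZ (form_alt sigma c_atlas cy)) set_row_id => /eqP.
by rewrite mulf_eq0 invr_eq0 gt_eqF ?sqrtr_gt0//= => /eqP.
Qed.

Lemma star_coefE : star_coef c y = calibration X c y E *: invmx S.
Proof.
have pS := induced_metric_positive_definite.
have d0 := positive_definite_det_gt0 pS.
have s0 : Num.sqrt (\det S) != 0 by rewrite gt_eqF// sqrtr_gt0.
rewrite /star_coef calibration_volume /invmx (positive_definite_unit pS) scalerA.
congr (_ *: _); apply: (mulfI s0); rewrite mulfV// mulrA -expr2.
by rewrite sqr_sqrtr ?(ltW d0)// mulfV// gt_eqF.
Qed.

Lemma star_coef_positive_definite : positive_definite (star_coef c y).
Proof.
have pS := induced_metric_positive_definite.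
rewrite star_coefE; apply: positive_definiteZ; last exact: positive_definiteV.
by rewrite calibration_volume sqrtr_gt0 positive_definite_det_gt0.
Qed.

(** On the submanifold the contraction of the calibration with the gradient of
    [f] is the Hodge star of [df]: by the first cousin principle the normal part
    of the gradient is lost. *)
Lemma d_phi_tangent (f : X -> R) (i : 'I_p.+1) :
  differentiable (f \o param c : 'rV[R]_n -> R) y ->
  d_phi f c y (row' i E) = (-1) ^+ i *
    \sum_j star_coef c y i j * 'D_(row j E) (f \o param c : 'rV[R]_n -> R) y.
Proof.
move=> df; have pG := metric_positive_definite.
have altphi := form_alt (calibration X) c_atlas cy.
rewrite /d_phi alt_col_mx_row'//; congr (_ * _).
rewrite (first_cousin (G := metric X c y)) ?calibration_volume//; last 3 first.
- by move=> V; exact: calibration_le1.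
- exact: pG.1.
- exact: induced_metric_positive_definite.
rewrite -calibration_volume -/(induced_metric c y) -/S /gradient.
rewrite mulmxKV ?positive_definite_unit//.
rewrite star_coefE [in LHS]mxE mulr_sumr; apply: eq_bigr => j _.
rewrite [in RHS]mxE.
have -> : invmx S i j = invmx S j i.
  by rewrite -[in RHS](positive_definiteV induced_metric_positive_definite).1 mxE.
rewrite -mulrA; congr (_ * _); rewrite mulrC; congr (_ * _).
rewrite derive_partial// mxE; apply: eq_bigr => k _.
by rewrite !mxE mulrC.
Qed.

End Pointwise.

End Calibrated.

Section LocalEquation.
Context (R : realType) (n p : nat) (X : calibrated_manifold R n p.+1).
Variables (M : set X) (O : set (chart R X n)).
Hypothesis M_phi : phi_submanifold M O.
Variables (c : chart R X n) (U : set 'rV[R]_p.+1).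
Hypothesis Oc : O c.
Hypothesis U_open : open U.

Let E : 'M[R]_(p.+1, n) := pid_mx p.+1.

Hypothesis U_chart : forall z, U z -> cimg c (z *m E) /\ M (param c (z *m E)).

Let c_atlas : atlas c.
Proof. by case: M_phi => _ [sub _ _] _; case: (sub _ Oc). Qed.

Let U_cimg z : U z -> cimg c (z *m E).
Proof. by move=> /U_chart[]. Qed.

Let U_M z : U z -> M (param c (z *m E)).
Proof. by move=> /U_chart[]. Qed.

Lemma class_C1_form q (w : Defs.form X q) (V : 'M[R]_(q, n)) :
  class_C 1 U (fun z => w c (z *m E) V).
Proof.
apply: (class_C1_mulmxr (W := cimg c) (F := fun y => w c y V)) => //.
exact: (form_smooth w V c_atlas 1%N).
Qed.

Lemma class_C1_star_coef i j : class_C 1 U (fun z => star_coef c (z *m E) i j).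
Proof.
under eq_fun do rewrite /star_coef mxE.
apply: (class_C1M U_open); last first.
  apply: (class_C1_adj U_open (A := fun z => induced_metric c (z *m E))) => k l.
  under eq_fun do rewrite /induced_metric mxE.
  apply: (class_C1_sum U_open) => b.
  apply: (class_C1M U_open); last exact: class_C1_cst.
  under eq_fun do rewrite mxE.
  apply: (class_C1_sum U_open) => a.
  apply: (class_C1M U_open); first exact: class_C1_cst.
  apply: (class_C1_mulmxr (W := cimg c) (F := fun y => metric X c y a b)) => //.
  exact: (metric_smooth (metric X) a b c_atlas 1%N).
apply: (class_C1V U_open); last exact: class_C1_form.
move=> z Uz; rewrite (calibration_volume M_phi Oc (U_cimg Uz) (U_M Uz)).
rewrite gt_eqF// sqrtr_gt0; apply: positive_definite_det_gt0.
exact: (induced_metric_positive_definite M_phi Oc (U_cimg Uz)).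
Qed.

Variables (f : X -> R) (alpha : Defs.form X p) (sigma : Defs.form X p.+1).
Hypothesis f_smooth : smooth_function f.
Hypothesis sigma0 : forall c y V, atlas c -> cimg c y -> phi_plane c y V ->
  sigma c y V = 0.
Hypothesis f_eq : forall c y V, atlas c -> cimg c y ->
  ext_d (d_phi f) c y V = d_wedge f alpha c y V + sigma c y V.

Let u (z : 'rV[R]_p.+1) : R := f (param c (z *m E)).

Let a (z : 'rV[R]_p.+1) : 'M[R]_p.+1 := star_coef c (z *m E).

(** The first order coefficients of the equation satisfied by [f] on [M]:
    the divergence of the star coefficients, minus the form [alpha]. *)
Definition drift (z : 'rV[R]_p.+1) (j : 'I_p.+1) : R :=
  \sum_i partial i (fun z => star_coef c (z *m E) i j) z
  - (-1) ^+ j * alpha c (z *m E) (row' j E).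

Let f_class_C k : class_C k (cimg c) (f \o param c : 'rV[R]_n -> R).
Proof. exact: f_smooth. Qed.

Lemma local_twice_differentiable z : U z -> twice_differentiable u z.
Proof.
move=> Uz.
exact: (@twice_differentiable_mulmxr _ _ _ E _ U _ z U_open U_cimg (f_class_C 2%N) Uz).
Qed.

Lemma continuous_drift z j : U z -> {for z, continuous (fun z => drift z j : R)}.
Proof.
move=> Uz; apply: continuous_atD.
  apply: continuous_at_sum => i.
  exact: (class_C1_derive_continuous (class_C1_star_coef i j) Uz).
have C := class_C1_continuous (class_C1_form alpha (row' j E)) Uz.
apply: continuousN; apply: (continuous_atM _ C); exact: cst_continuous.
Qed.

Let partial_u j z : partial j u z = 'D_(row j E) (f \o param c : 'rV[R]_n -> R) (z *m E).
Proof. by rewrite rowE; exact: derive_mulmxr. Qed.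

(** Restricting the equation satisfied by [d d^phi f] to the tangent planes of
    [M] kills the term that vanishes on calibrated planes and leaves
    [d * df = df /\ alpha], an elliptic equation without zero order term. *)
Lemma local_laplace_equation z : U z -> elliptic a drift u z = 0.
Proof.
move=> Uz.
have da i j : differentiable (fun z => star_coef c (z *m E) i j) z.
  by have [d _] := class_C1_star_coef i j; exact: d.
have tu := local_twice_differentiable Uz.
pose W i : 'rV[R]_p.+1 -> R :=
  \sum_j (fun z => star_coef c (z *m E) i j) * partial j u.
have dWj i j : differentiable ((fun z => star_coef c (z *m E) i j) * partial j u) z.
  by apply: differentiableM; [exact: da|exact: tu.2].
have dW i : differentiable (W i) z by exact: differentiable_sum.
have pW i : partial i (W i) z = \sum_j (a z i j * partial i (partial j u) z
    + partial j u z * partial i (fun z => star_coef c (z *m E) i j) z).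
  rewrite /partial /W derive_sum => [|j]; last exact/diff_derivable/dWj.
  by apply: eq_bigr => j _; exact: partialM (da i j) (tu.2 j).
have dphi i : 'D_(row i E) (fun y => d_phi f c y (row' i E) : R) (z *m E)
    = (-1) ^+ i * partial i (W i) z.
  rewrite rowE -(derive_mulmxr E (fun y => d_phi f c y (row' i E) : R)).
  rewrite -(partialZ _ i (dW i)); apply: near_eq_derive.
  have : \forall y \near z, U y by exact: open_nbhs_nbhs.
  apply: filterS => y Uy.
  have df : differentiable (f \o param c : 'rV[R]_n -> R) (y *m E).
    by apply: (f_class_C 1%N).1; exact: U_cimg.
  rewrite (d_phi_tangent M_phi Oc (U_cimg Uy) (U_M Uy) i df).
  congr (_ * _); rewrite /W fct_sumE; apply: eq_bigr => j _.
  by rewrite -partial_u.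
have := f_eq E c_atlas (U_cimg Uz).
rewrite (form_eq0_tangent M_phi Oc (U_cimg Uz) (U_M Uz)) ?addr0; last first.
  by move=> V; exact: sigma0 c_atlas (U_cimg Uz).
rewrite /ext_d (eq_bigr (fun i => partial i (W i) z)) => [|i _]; last first.
  by rewrite dphi mulrA -exprD addnn -mul2n exprM sqrrN !expr1n mul1r.
under eq_bigr do rewrite pW big_split.
rewrite big_split /= => eq1.
have -> : elliptic a drift u z = \sum_i \sum_j a z i j * partial i (partial j u) z
    + \sum_i \sum_j partial j u z * partial i (fun z => star_coef c (z *m E) i j) z
    - d_wedge f alpha c (z *m E) E.
  rewrite /elliptic -addrA; congr (_ + _).
  rewrite exchange_big -sumrB; apply: eq_bigr => j _.
  by rewrite /drift mulrBl -mulr_sumr partial_u; ring.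
by rewrite eq1 subrr.
Qed.

(** The factor [e] is there to treat [f] and [- f] at once. *)
Lemma local_strong_maximum_principle (e m : R) (z0 : 'rV[R]_p.+1) :
  (forall z, U z -> e * u z <= m) -> U z0 -> e * u z0 = m ->
  \forall z \near z0, e * u z = m.
Proof.
have t0 z : twice_differentiable (cst 0 : 'rV[R]_p.+1 -> R) z.
  split=> [|j]; first by near=> y.
  by rewrite (_ : partial j _ = cst 0)//; apply/funext => y; exact: partial_cst.
have e0 z : elliptic a drift (cst 0) z = 0.
  have p0 j : partial j (cst 0 : 'rV[R]_p.+1 -> R) = cst 0.
    by apply/funext => y; exact: partial_cst.
  rewrite /elliptic big1 => [|i _]; last first.
    by rewrite big1// => j _; rewrite p0 partial_cst mulr0.
  by rewrite add0r big1// => j _; rewrite p0 mulr0.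
have euE : (cst 0 + e *: u : 'rV[R]_p.+1 -> R) = fun z => e * u z.
  by apply/funext => z; rewrite !fctE /= add0r.
move=> eum Uz0 euz0.
apply: (@strong_maximum_principle R p.+1 U a drift (fun z => e * u z) m) => //.
- by move=> z Uz; exact: (star_coef_positive_definite M_phi Oc (U_cimg Uz) (U_M Uz)).
- by move=> z i j Uz; exact: (class_C1_continuous (class_C1_star_coef i j) Uz).
- by move=> z j; exact: continuous_drift.
- by move=> z Uz; rewrite -euE; apply: twice_differentiableDZ => //;
    exact: local_twice_differentiable.
- move=> z Uz; rewrite -euE ellipticDZ//; last exact: local_twice_differentiable.
  by rewrite e0 local_laplace_equation// mulr0 addr0.
Unshelve. all: by end_near. Qed.

End LocalEquation.

(** * The maximum principle *)

Lemma smooth_function_continuous (R : realType) (n : nat)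
    (X : smooth_manifold R n) (f : X -> R) :
  smooth_function f -> continuous f.
Proof.
move=> fs x; have [c ac cx] := atlas_cover x.
have e : \near x, ((f \o param c : 'rV[R]_n -> R) \o c) x = f x.
  have : \forall y \near x, cdom c y.
    by apply: open_nbhs_nbhs; split; [exact: cdom_open|].
  by apply: filterS => y cy /=; rewrite coordK.
apply: near_eq_continuous e _.
apply: continuous_comp; first exact: Defs.coord_continuous.
apply: differentiable_continuous; apply: (fs c ac 1%N).1; by exists x.
Qed.

Lemma sum_pid_mx0 (R : realType) (n p : nat) (z : 'rV[R]_p.+1) (i : 'I_n) :
  i = 0%N :> nat -> (z *m (pid_mx p.+1 : 'M[R]_(p.+1, n))) 0 i = z 0 0.
Proof.
move=> i0; rewrite mxE (bigD1 0)//= mxE i0 /= mulr1 big1 ?addr0// => k k0.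
have /negbTE kn : (k : nat) != 0%N by [].
by rewrite mxE i0 kn mulr0.
Qed.

Section Global.
Context (R : realType) (n p : nat) (X : calibrated_manifold R n p.+1).
Variables (M : set X) (O : set (chart R X n)) (f : X -> R).
Hypothesis M_phi : phi_submanifold M O.
Hypothesis f_smooth : smooth_function f.
Hypothesis f_pluriharmonic : pluriharmonic_mod_d f.

Let E : 'M[R]_(p.+1, n) := pid_mx p.+1.
Let P : 'M[R]_(n, p.+1) := pid_mx p.+1.

(** Around an interior point the submanifold is a piece of the coordinate plane:
    in a half-plane chart the first coordinate does not vanish there, otherwise
    the point would belong to the boundary. *)
Lemma interior_point_chart (c : chart R X n) (x : X) :
  O c -> M x -> cdom c x -> ~ manifold_boundary p.+1 M x ->
  (forall y, cdom c y -> M y -> c y *m P *m E = c y) /\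
  exists U : set 'rV[R]_p.+1, [/\ open U, U (c x *m P) &
    forall z, U z -> cimg c (z *m E) /\ M (param c (z *m E))].
Proof.
move=> Oc Mx cx xB.
have [pn ac cuts] : adapted_chart p.+1 M c.
  by case: M_phi => _ [sub _ _] _; exact: sub.
have flat y : cdom c y -> M y -> coord_plane p.+1 (c y).
  by case: cuts => [cuts|[s cuts]] cy /(cuts _ cy) => [|[]].
have flatK y : cdom c y -> M y -> c y *m P *m E = c y.
  by move=> cy My; apply: coord_plane_pid_mxK => //; exact: flat.
split=> //.
suff [V [Vo Vx VM]] : exists V : set 'rV[R]_p.+1, [/\ open V, V (c x *m P) &
    forall z, V z -> cimg c (z *m E) -> M (param c (z *m E))].
  exists (V `&` (fun z => z *m E) @^-1` cimg c); split.
  - apply: openI => //; apply: open_comp => [z _|]; first exact: continuous_mulmxr.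
    exact: cimg_open.
  - by split=> //=; rewrite flatK//; exists x.
  - by move=> z [Vz cz]; split=> //; exact: VM.
have toM z y : y = z *m E -> cimg c y -> cdom c (param c y) /\ c (param c y) = y.
  by move=> _ [t ct <-]; rewrite coordK.
case: cuts => [cuts|[s cuts]].
  exists setT; split=> //; first exact: openT.
  move=> z _ cz; have [ct ctE] := toM z _ erefl cz.
  by apply/(cuts _ ct); rewrite ctE; exact: pid_mx_coord_plane.
pose i0 : 'I_n := Ordinal (leq_ltn_trans (leq0n p) pn).
have xP : (c x *m P) 0 0 = c x 0 i0.
  by rewrite -(@sum_pid_mx0 _ n _ _ i0)// -/E flatK.
exists [set z | 0 < (-1) ^+ s * z 0 0]; split.
- have C : continuous (fun z : 'rV[R]_p.+1 => (-1) ^+ s * z 0 0 : R).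
    move=> z.
    apply: (@continuous_atM _ _ (cst ((-1) ^+ s)) (fun z : 'rV[R]_p.+1 => z 0 0)).
      exact: cst_continuous.
    exact/differentiable_continuous/differentiable_coord.
  exact: (@open_comp _ _ _ [set r : R | 0 < r] (fun z _ => C z) (@open_gt R 0)).
- have [_ /(_ i0 erefl)] := (cuts _ cx).1 Mx.
  rewrite /= xP le_eqVlt => /orP[/eqP h|//].
  case: xB; split=> //; exists c, s; split=> // i ii0.
  have -> : i = i0 by exact: val_inj.
  by apply/eqP; move/esym/eqP: h; rewrite mulf_eq0 signr_eq0.
- move=> z /= Vz cz; have [ct ctE] := toM z _ erefl cz.
  apply/(cuts _ ct); rewrite ctE; split; first exact: pid_mx_coord_plane.
  by move=> i ii0; rewrite /= sum_pid_mx0// ltW.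
Qed.

Lemma locally_constant_at_max (e m : R) (x : X) :
  M x -> ~ manifold_boundary p.+1 M x ->
  (forall y, M y -> e * f y <= m) -> e * f x = m ->
  \forall y \near x, M y -> e * f y = m.
Proof.
move=> Mx xB fm fx.
have [_ [_ cover _] _] := M_phi; have [c Oc cx] := cover _ Mx.
have [flatK [U [Uo Ux UM]]] := interior_point_chart Oc Mx cx xB.
have [alpha [sigma [sigma0 f_eq]]] := f_pluriharmonic.
have key : \forall z \near c x *m P, e * f (param c (z *m E)) = m.
  apply: (local_strong_maximum_principle M_phi Oc Uo UM f_smooth sigma0 f_eq) => //.
    by move=> z /UM[_]; exact: fm.
  by rewrite flatK// coordK.
have PC : {for x, continuous (fun y => c y *m P)}.
  apply: (@continuous_comp _ _ _ c (fun y : 'rV[R]_n => y *m P)).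
    exact: Defs.coord_continuous.
  exact: continuous_mulmxr.
have near_c : \forall y \near x, cdom c y.
  by apply: open_nbhs_nbhs; split; [exact: cdom_open|].
have near_key := PC _ key.
near=> y => My.
have cy : cdom c y by near: y.
have : e * f (param c (c y *m P *m E)) = m by near: y.
by rewrite flatK// coordK.
Unshelve. all: by end_near. Qed.

Hypothesis M_compact : compact M.
Hypothesis components_meet_boundary : forall x, M x ->
  connected_component M x `&` manifold_boundary p.+1 M !=set0.

(** The maximum set of [e f] is open in [M] away from the boundary, and closed:
    were it disjoint from the boundary it would fill a connected component. *)
Lemma maximum_principle (e : R) (x : X) : M x ->
  e * f x <= sup ((fun y => e * f y) @` manifold_boundary p.+1 M).
Proof.
move=> Mx; set G := manifold_boundary p.+1 M; set F := fun y => e * f y.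
have FC : continuous F.
  move=> y; apply: (@continuous_atM _ _ (cst e) f); first exact: cst_continuous.
  exact: smooth_function_continuous.
have [xm + mle] : exists2 c, c \in M & forall t, t \in M -> F t <= F c.
  apply: compact_EVT_max => //; first by exists x.
  exact: continuous_subspaceT.
rewrite inE => Mxm; set m := F xm in mle.
have Fm y : M y -> F y <= m by move=> My; apply: mle; rewrite inE.
have FG y : G y -> F y <= sup (F @` G).
  move=> Gy; apply: sup_upper_bound; last by exists y.
  split; first by exists (F y), y.
  by exists m => _ [t [Mt _] <-]; exact: Fm.
apply: le_trans (Fm _ Mx) _; rewrite leNgt; apply/negP => supm.
have offG y : M y -> F y = m -> ~ G y.
  by move=> My Fy /FG; rewrite Fy leNgt supm.
pose C := connected_component M xm.
have CM : C `<=` M by exact: connected_component_sub.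
have [y [Cy Gy]] := components_meet_boundary Mxm.
suff BC : C `&` [set t | F t = m] = C.
  have [_ Fy] : (C `&` [set t | F t = m]) y by rewrite BC.
  exact: (offG y (CM _ Cy) Fy).
apply: (@component_connected _ M xm).
- by exists xm; split=> //; exact: connected_component_refl.
- exists (interior [set t | M t -> F t = m]); first exact: open_interior.
  apply/seteqP; split=> t [Ct].
    move=> Ft; split=> //; apply: locally_constant_at_max => //; first exact: CM.
    by apply: offG => //; exact: CM.
  by move=> /interior_subset /= Ft; split=> //; apply: Ft; exact: CM.
- exists [set t | F t = m] => //.
  rewrite (_ : mkset _ = F @^-1` [set r : R | r = m])//.
  by apply: preimage_closed => [t _|]; [exact: FC|exact: closed_eq].
Qed.

End Global.

Theorem corollary10p5 (R : realType) (n p : nat)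
    (X : calibrated_manifold R n p.+1)
    (M Gamma : set X) (O : set (chart R X n))
    (M_phi : phi_submanifold M O)
    (M_compact : compact M)
    (Gamma_boundary : Gamma = manifold_boundary p.+1 M)
    (components_meet_boundary :
       forall x, M x -> connected_component M x `&` Gamma !=set0)
    (f : X -> R) (f_smooth : smooth_function f)
    (f_pluriharmonic : pluriharmonic_mod_d f)
    (x : X) (Mx : M x) :
  inf (f @` Gamma) <= f x <= sup (f @` Gamma).
Proof.
rewrite {}Gamma_boundary in components_meet_boundary *.
have max e := maximum_principle M_phi f_smooth f_pluriharmonic M_compact
  components_meet_boundary e Mx.
apply/andP; split; last first.
  have := max 1; rewrite mul1r.
  by have -> : (fun y => 1 * f y) = f by apply/funext => y; rewrite mul1r.
have := max (- 1); rewrite mulN1r /inf lerNl image_comp.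
by have -> : (fun y => -1 * f y) = -%R \o f by apply/funext => y; rewrite mulN1r.
Qed.
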